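(* Let $1\le k\le\infty$, let $X$ be a compactly aligned product system of Hilbert $A$-bimodules over $\mathbb{N}^{\oplus k}$, and let $\psi$ be an injective CNP-covariant representation of $X$. Then $$\widetilde{\kappa}^\psi:=\varinjlim_{n\in\mathbb{N}^{\oplus k}}\widetilde{\kappa}_n^\psi:\ \varinjlim_{n\in\mathbb{N}^{\oplus k}}(\widetilde{C}_n,\widetilde{j}_{m,n})\longrightarrow C^*(\psi)^{\mathrm{core}}$$ is isometric.
   Context: **Semigroup.** $\mathbb{N}=\{0,1,2,\dots\}$, $1\le k\le\infty$; $\mathbb{N}^{\oplus k}$ is the direct sum with coordinatewise order $\le$ and $m\vee n$ the coordinatewise maximum. **Hilbert bimodules.** A Hilbert $A$-bimodule ($A$ a $C^*$-algebra) is a right Hilbert $A$-module $Y$ with a $*$-homomorphism $\phi:A\to\mathcal{L}(Y)$ (left action). $\mathcal{K}(Y)$ is the closed span of $\theta_{\xi,\eta}(\zeta)=\xi\langle\eta,\zeta\rangle$. For a closed ideal $I$ of $A$, $YI=\{\xi\in Y:\langle\xi,\xi\rangle\in I\}$. ${}_AA_A$ is $A$ as a bimodule over itself, $\mathcal{K}({}_AA_A)=\{L_a:a\in A\}$ with $L_a$ left multiplication. **Product systems.** A product system $X$ over $\mathbb{N}^{\oplus k}$ is a semigroup $X=\bigsqcup_nX_n$ fibred over $\mathbb{N}^{\oplus k}$, each $X_n$ a Hilbert $A$-bimodule with left action $\phi_n$, such that $X_0={}_AA_A$; for $m,n\ne0$ multiplication induces an isomorphism $M_{m,n}:X_m\otimes_AX_n\to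 X_{m+n}$; and products with elements of $X_0=A$ are the left and right actions. For $n\le m$ define $\iota_n^m:\mathcal{K}(X_n)\to\mathcal{L}(X_m)$ by $\iota_n^m(S)=M_{n,m-n}(S\otimes1)M_{n,m-n}^{-1}$ if $0<n<m$, $\iota_0^m(L_a)=\phi_m(a)$, $\iota_n^n(S)=S$. $X$ is compactly aligned if $\iota_m^{m\vee n}(S_1)\iota_n^{m\vee n}(S_2)\in\mathcal{K}(X_{m\vee n})$ for all $m,n$, $S_1\in\mathcal{K}(X_m)$, $S_2\in\mathcal{K}(X_n)$. **Representations.** A representation of $X$ in a $C^*$-algebra $B$ is a map $\psi:X\to B$, $\psi_n=\psi|_{X_n}$, with $\psi_0$ a $*$-homomorphism, each $\psi_n$ linear, $\psi_n(\xi)^*\psi_n(\eta)=\psi_0(\langle\xi,\eta\rangle_A^n)$, $\psi_m(\xi)\psi_n(\eta)=\psi_{m+n}(\xi\eta)$. $\psi^{(n)}:\mathcal{K}(X_n)\to B$ is determined by $\psi^{(n)}(\theta_{\xi,\eta})=\psi_n(\xi)\psi_n(\eta)^*$. $\psi$ is injective if $\psi_0$ (equivalently each $\psi_n$) is. $\psi$ is Nica covariant if $\psi^{(m)}(S_1)\psi^{(n)}(S_2)=\psi^{(m\vee n)}(\iota_m^{m\vee n}(S_1)\iota_n^{m\vee n}(S_2))$ always. Then $C^*(\psi)^{\mathrm{core}}=\overline{\mathrm{span}}\{\psi_n(\xi)\psi_n(\eta)^*:n\in\mathbb{N}^{\oplus k},\xi,\eta\in X_n\}$, a $C^*$-algebra.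 Put $I_0=A$, $I_n=\bigcap_{0<m\le n}\ker\phi_m$ ($n\ne0$). For $p\le n$, $\widetilde\iota_p^n:\mathcal{K}(X_p)\to\bigoplus_{0\le q\le n}\mathcal{L}(X_qI_{n-q})$ has $q$-component $\iota_p^q(S)|_{X_qI_{n-q}}$ if $p\le q$ and $0$ otherwise. A statement $P(q)$ holds for large $q$ if for every $n\in\mathbb{N}^{\oplus k}$ there is $m\ge n$ such that $P(q)$ holds for all $q\ge m$. A Nica covariant $\psi$ is CNP-covariant if $\sum_{p\in F}\psi^{(p)}(S_p)=0$ whenever $F\subset\mathbb{N}^{\oplus k}$ is finite, $S_p\in\mathcal{K}(X_p)$ and $\sum_{p\in F}\widetilde\iota_p^q(S_p)=0$ for large $q$. **The algebras.** $C_n=\mathrm{span}\{\widetilde\iota_p^n(S_p):0\le p\le n,\ S_p\in\mathcal{K}(X_p)\}$, a $C^*$-subalgebra of $\bigoplus_{0\le q\le n}\mathcal{L}(X_qI_{n-q})$. $$\widetilde C_n=\Bigl\{\Bigl(\sum_{p\le n}\widetilde\iota_p^q(S_p)\Bigr)_{\{q:n\le q\}}\in\prod_{n\le q}C_q:\ S_p\in\mathcal{K}(X_p)\ (p\le n)\Bigr\},$$ a $C^*$-algebra. For $n\le m$, $\widetilde j_{m,n}:\widetilde C_n\to\widetilde C_m$ is the ($*$-homomorphic, injective) restriction map $\bigl(\sum_{p\le n}\widetilde\iota_p^q(S_p)\bigr)_{\{q:n\le q\}}\mapsto\bigl(\sum_{p\le n}\widetilde\iota_p^q(S_p)\bigr)_{\{q:m\le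 q\}}$. For CNP-covariant $\psi$, $\widetilde\kappa_n^\psi:\widetilde C_n\to C^*(\psi)^{\mathrm{core}}$ is the (well-defined) $*$-homomorphism $\bigl(\sum_{p\le n}\widetilde\iota_p^q(S_p)\bigr)_{\{q:n\le q\}}\mapsto\sum_{p\le n}\psi^{(p)}(S_p)$; these satisfy $\widetilde\kappa_m^\psi\circ\widetilde j_{m,n}=\widetilde\kappa_n^\psi$. *)

(* Defs.v *)
From HB Require Import structures.
From mathcomp Require Import all_boot all_order all_algebra finmap.
From mathcomp Require Import complex.
From mathcomp Require Import all_classical all_reals all_analysis.

Set Implicit Arguments.
Unset Strict Implicit.
Unset Printing Implicit Defensive.

Import Order.TTheory GRing.Theory Num.Theory.
Import numFieldNormedType.Exports.

Local Open Scope classical_set_scope.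
Local Open Scope ring_scope.

(* MathComp rings are unital while C*-algebras need not be, so the product is
   introduced here.  Norms take their values in R[i]. *)
HB.mixin Record isCStarAlgebra (R : realType) A
    of CompleteNormedModule R[i] A := {
  cmul : A -> A -> A;
  cstar : A -> A;
  cmulA : forall a b c : A, cmul a (cmul b c) = cmul (cmul a b) c;
  cmulDl : forall a b c : A, cmul (a + b) c = cmul a c + cmul b c;
  cmulDr : forall a b c : A, cmul a (b + c) = cmul a b + cmul a c;
  cmulZl : forall (z : R[i]) (a b : A), cmul (z *: a) b = z *: cmul a b;
  cmulZr : forall (z : R[i]) (a b : A), cmul a (z *: b) = z *: cmul a b;
  cstarK : forall a : A, cstar (cstar a) = a;
  cstarD : forall a b : A, cstar (a + b) = cstar a + cstar b;
  cstarZ : forall (z : R[i]) (a : A), cstar (z *: a) = Num.conj z *: cstar a;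
  cstarM : forall a b : A, cstar (cmul a b) = cmul (cstar b) (cstar a);
  cnormM : forall a b : A, `|cmul a b| <= `|a| * `|b|;
  cnorm_star : forall a : A, `|cmul (cstar a) a| = `|a| ^+ 2
}.

#[short(type="cstarAlgType")]
HB.structure Definition CStarAlgebra (R : realType) :=
  {A of isCStarAlgebra R A & CompleteNormedModule R[i] A}.

Definition star_hom (R : realType) (A B : cstarAlgType R) (f : A -> B) : Prop :=
  [/\ forall (z : R[i]) (a b : A), f (z *: a + b) = z *: f a + f b,
      forall a b : A, f (cmul a b) = cmul (f a) (f b) &
      forall a : A, f (cstar a) = cstar (f a)].

HB.mixin Record isHilbertModule (R : realType) (A : cstarAlgType R) Y
    of CompleteNormedModule R[i] Y := {
  ract : Y -> A -> Y;
  ractDl : forall (x y : Y) (a : A), ract (x + y) a = ract x a + ract y a;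
  ractDr : forall (x : Y) (a b : A), ract x (a + b) = ract x a + ract x b;
  ractZl : forall (z : R[i]) (x : Y) (a : A), ract (z *: x) a = z *: ract x a;
  ractZr : forall (z : R[i]) (x : Y) (a : A), ract x (z *: a) = z *: ract x a;
  ractM : forall (x : Y) (a b : A), ract x (cmul a b) = ract (ract x a) b;
  inner : Y -> Y -> A;
  innerDr : forall x y y' : Y, inner x (y + y') = inner x y + inner x y';
  innerZr : forall (z : R[i]) (x y : Y), inner x (z *: y) = z *: inner x y;
  inner_ract : forall (x y : Y) (a : A), inner x (ract y a) = cmul (inner x y) a;
  inner_star : forall x y : Y, cstar (inner x y) = inner y x;
  inner_ge0 : forall x : Y, exists b : A, inner x x = cmul (cstar b) b;
  inner_norm : forall x : Y, `|x| ^+ 2 = `|inner x x|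
}.

#[short(type="hilbertModType")]
HB.structure Definition HilbertModule (R : realType) (A : cstarAlgType R) :=
  {Y of isHilbertModule R A Y & CompleteNormedModule R[i] Y}.

(* lact_adj makes every lact a adjointable with adjoint lact a^*; together
   the axioms say that lact is a *-homomorphism from A to L(Y). *)
HB.mixin Record hasLeftAction (R : realType) (A : cstarAlgType R) Y
    of HilbertModule R A Y := {
  lact : A -> Y -> Y;
  lactDl : forall (a b : A) (x : Y), lact (a + b) x = lact a x + lact b x;
  lactZl : forall (z : R[i]) (a : A) (x : Y), lact (z *: a) x = z *: lact a x;
  lactM : forall (a b : A) (x : Y), lact (cmul a b) x = lact a (lact b x);
  lact_adj : forall (a : A) (x y : Y),
    inner (lact a x) y = inner x (lact (cstar a) y)
}.

#[short(type="hilbertBimodType")]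
HB.structure Definition HilbertBimodule (R : realType) (A : cstarAlgType R) :=
  {Y of hasLeftAction R A Y & HilbertModule R A Y}.

Definition linear_span (K : numFieldType) (V : lmodType K) (S : set V) : set V :=
  [set x | exists (l : nat) (c : 'I_l -> K) (v : 'I_l -> V),
     (forall i, S (v i)) /\ x = \sum_(i < l) c i *: v i].

Section Operators.
Context (R : realType) (A : cstarAlgType R).

(* Adjointable maps are automatically linear, A-linear and bounded. *)
Definition adjointable (Y : hilbertModType A) : set (Y -> Y) :=
  [set T | exists T' : Y -> Y, forall x y, inner (T x) y = inner x (T' y)].

Definition theta (Y : hilbertModType A) (x y : Y) : Y -> Y :=
  fun z => ract x (inner y z).

Definition opdist_le (Y : hilbertModType A) (S T : Y -> Y) (e : R[i]) : Prop :=
  forall z : Y, `|S z - T z| <= e * `|z|.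

Definition compact_op (Y : hilbertModType A) : set (Y -> Y) :=
  [set S | adjointable S /\
     forall e : R[i], 0 < e ->
       exists2 T : Y -> Y,
         linear_span [set U | exists x y : Y, U = theta x y] T &
         opdist_le S T e].

(* (T, tau) is the interior tensor product of Y and Z over A, i.e. the
   completion of the algebraic tensor product for the usual inner product:
   tau is the A-balanced bimodule map sending (y, z) to its elementary tensor *)
Record is_tensor (Y Z T : hilbertBimodType A) (tau : Y -> Z -> T) : Prop := {
  tensor_linl : forall (c : R[i]) y y' z,
    tau (c *: y + y') z = c *: tau y z + tau y' z;
  tensor_linr : forall (c : R[i]) y z z',
    tau y (c *: z + z') = c *: tau y z + tau y z';
  tensor_balanced : forall y (a : A) z, tau (ract y a) z = tau y (lact a z);
  tensor_lact : forall (a : A) y z, lact a (tau y z) = tau (lact a y) z;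
  tensor_ract : forall y z (a : A), ract (tau y z) a = tau y (ract z a);
  tensor_inner : forall y z y' z',
    inner (tau y z) (tau y' z') = inner z (lact (inner y y') z') :> A;
  tensor_dense :
    closure (linear_span [set t : T | exists y z, t = tau y z]) = setT
}.

End Operators.

(* The rank k is Some d for k = d, and None for k = oo. *)
Definition rank_ge1 (k : option nat) : Prop :=
  if k is Some d then (1 <= d)%N else True.

Definition rank_index (k : option nat) : countType :=
  if k is Some d then ('I_d : countType) else (nat : countType).

Definition Nsum (k : option nat) := {fsfun rank_index k -> nat with 0%N}.

Section Semigroup.
Context (k : option nat).
Implicit Types m n : Nsum k.

Definition Nzero : Nsum k := [fsfun with 0%N].

Definition Nadd m n : Nsum k :=
  [fsfun i in (finsupp m `|` finsupp n)%fset => (m i + n i)%N | 0%N].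

Definition Nsub m n : Nsum k := [fsfun i in finsupp m => (m i - n i)%N | 0%N].

Definition Njoin m n : Nsum k :=
  [fsfun i in (finsupp m `|` finsupp n)%fset => maxn (m i) (n i) | 0%N].

Definition Nle m n : Prop := forall i, (m i <= n i)%N.

Definition holds_for_large (P : Nsum k -> Prop) : Prop :=
  forall n, exists2 m, Nle n m & forall q, Nle m q -> P q.

End Semigroup.

Arguments Nzero {k}.

(* - psunit identifies the bimodule A over itself with X_0.
   - psmul carries a proof that the degrees add up, so that associativity needs
     no transport; the proof is irrelevant as Nsum k has decidable equality. *)
Record product_system (R : realType) (A : cstarAlgType R) (k : option nat) := {
  fibre :> Nsum k -> hilbertBimodType A;
  psunit : A -> fibre Nzero;
  psmul : forall m n q : Nsum k,
    Nadd m n = q -> fibre m -> fibre n -> fibre q;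
  psunit_bij : bijective psunit;
  psunit_lin : forall (c : R[i]) (a b : A),
    psunit (c *: a + b) = c *: psunit a + psunit b;
  psunit_inner : forall a b : A, inner (psunit a) (psunit b) = cmul (cstar a) b;
  psunit_ract : forall a b : A, ract (psunit a) b = psunit (cmul a b);
  psunit_lact : forall a b : A, lact a (psunit b) = psunit (cmul a b);
  psmulA : forall (l m n lm mn q : Nsum k)
      (e1 : Nadd l m = lm) (e2 : Nadd lm n = q)
      (e3 : Nadd m n = mn) (e4 : Nadd l mn = q) x y z,
    psmul e2 (psmul e1 x y) z = psmul e4 x (psmul e3 y z);
  psmul_unitl : forall (n : Nsum k) (e : Nadd Nzero n = n) (a : A) x,
    psmul e (psunit a) x = lact a x;
  psmul_unitr : forall (n : Nsum k) (e : Nadd n Nzero = n) x (a : A),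
    psmul e x (psunit a) = ract x a;
  psmul_tensor : forall (m n q : Nsum k) (e : Nadd m n = q),
    m <> Nzero -> n <> Nzero -> is_tensor (psmul e)
}.

Arguments psunit {R A k} p.
Arguments psmul {R A k} p {m n q}.

Section ProductSystem.
Context (R : realType) (A : cstarAlgType R) (k : option nat).
Context (X : product_system A k).
Implicit Types m n p q r : Nsum k.

(* iota_graph S T means T = iota_p^q(S).  In the second case lact a on X_0 is
   L_a.  In the third, the equations say that T is M (S (x) 1) M^-1. *)
Inductive iota_graph : forall p q, (X p -> X p) -> (X q -> X q) -> Prop :=
| iota_same p (S : X p -> X p) : iota_graph S S
| iota_zero q (a : A) : iota_graph (lact a : X Nzero -> X Nzero)
                                   (lact a : X q -> X q)
| iota_tensor p d q (e : Nadd p d = q) (S : X p -> X p) (T : X q -> X q) :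
    p <> Nzero -> d <> Nzero -> adjointable T ->
    (forall (x : X p) (y : X d), T (psmul X e x y) = psmul X e (S x) y) ->
    iota_graph S T.

(* Meaningful for p <= q and S compact *)
Definition iota_op p q (S : X p -> X p) : X q -> X q :=
  xget (fun=> 0) [set T | iota_graph S T].

Arguments iota_op {p} q S _.

Definition compactly_aligned : Prop :=
  forall m n (S1 : X m -> X m) (S2 : X n -> X n),
    compact_op S1 -> compact_op S2 ->
    compact_op (iota_op (Njoin m n) S1 \o iota_op (Njoin m n) S2).

(* For n = 0 the intersection is empty, so I_0 = A. *)
Definition idealI n : set A :=
  [set a | forall m, m <> Nzero -> Nle m n -> forall x : X m, lact a x = 0].

(* X_q I_(n-q), for q <= n *)
Definition XI n q : set (X q) := [set x | idealI (Nsub n q) (inner x x)].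

Arguments XI n q : clear implicits.

(* An operator on the submodule X_q I_(n-q) is represented by its extension by
   0 to X_q; an element of the direct sum of the L(X_q I_(n-q)) for q <= n by
   the family of these, with component 0 at every other q. *)
Definition iota_tilde p n (S : X p -> X p) : forall q, X q -> X q :=
  fun q => if `[< Nle p q /\ Nle q n >]
           then patch (fun=> 0) (XI n q) (iota_op q S) else 0.

Arguments iota_tilde {p} n S q _.

(* A family indexed by {q | n <= q} whose value at q lies in the direct sum of
   the L(X_r I_(q-r)), r <= q; again extended by 0 to all indices. *)
Definition opfamily := forall q r, X r -> X r.

Definition tilde_elt n (S : forall p, X p -> X p) : opfamily :=
  fun q r => if `[< Nle n q >]
             then \sum_(p \in [set p | Nle p n]) iota_tilde q (S p) r else 0.

Definition compact_upto n (S : forall p, X p -> X p) : Prop :=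
  forall p, Nle p n -> compact_op (S p).

(* These families automatically lie in the bounded product of the C_q, n <= q:
   p <= n <= q, and the norms are at most the sum of the norms of the S p. *)
Definition Ctilde n : set opfamily :=
  [set x | exists2 S, compact_upto n S & x = tilde_elt n S].

Definition jtilde m (x : opfamily) : opfamily :=
  fun q r => if `[< Nle m q >] then x q r else 0.

Definition opfamily_lin (c : R[i]) (x y : opfamily) : opfamily :=
  fun q r => c *: x q r + y q r.

Definition opfamily_mul (x y : opfamily) : opfamily := fun q r => x q r \o y q r.

Definition opfamily_adjoint (x y : opfamily) : Prop :=
  forall q r, Nle r q -> forall u v : X r, XI q r u -> XI q r v ->
    inner (x q r u) v = inner u (y q r v).

(* f restricts to a *-homomorphism from Ctilde n to D *)
Definition Ctilde_star_hom n (D : cstarAlgType R) (f : opfamily -> D) : Prop :=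
  forall x y, Ctilde n x -> Ctilde n y ->
  [/\ forall c : R[i], f (opfamily_lin c x y) = c *: f x + f y,
      f (opfamily_mul x y) = cmul (f x) (f y) &
      opfamily_adjoint x y -> f y = cstar (f x)].

Definition is_cocone (D : cstarAlgType R) (f : Nsum k -> opfamily -> D) : Prop :=
  (forall n, Ctilde_star_hom n (f n)) /\
  (forall n m, Nle n m -> forall x, Ctilde n x -> f m (jtilde m x) = f n x).

(* (L, lam) is the inductive limit of (Ctilde n, jtilde) in the category of
   C*-algebras and *-homomorphisms *)
Definition is_inductive_limit (L : cstarAlgType R)
    (lam : Nsum k -> opfamily -> L) : Prop :=
  is_cocone lam /\
  forall (D : cstarAlgType R) (f : Nsum k -> opfamily -> D), is_cocone f ->
    exists! g : L -> D,
      star_hom g /\ forall n x, Ctilde n x -> g (lam n x) = f n x.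

Section Representation.
Context (B : cstarAlgType R) (psi : forall n, X n -> B).

Definition is_representation : Prop :=
  [/\ star_hom (fun a : A => psi (psunit X a)),
      forall n (c : R[i]) (x y : X n), psi (c *: x + y) = c *: psi x + psi y,
      forall n (x y : X n),
        cmul (cstar (psi x)) (psi y) = psi (psunit X (inner x y)) &
      forall m n q (e : Nadd m n = q) (x : X m) (y : X n),
        cmul (psi x) (psi y) = psi (psmul X e x y)].

Definition rep_injective : Prop := injective (psi (n:=Nzero)).

(* The continuous extension to the compact operators of the linear map
   theta x y |-> psi_n(x) psi_n(y)^* (scalars are absorbed in x) *)
Definition psiK n (S : X n -> X n) : B :=
  xget 0 [set b | forall e : R[i], 0 < e ->
    exists (l : nat) (x y : 'I_l -> X n),
      opdist_le S (\sum_(i < l) theta (x i) (y i)) e /\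
      `|b - \sum_(i < l) cmul (psi (x i)) (cstar (psi (y i)))| <= e].

Definition nica_covariant : Prop :=
  forall m n (S1 : X m -> X m) (S2 : X n -> X n),
    compact_op S1 -> compact_op S2 ->
    cmul (psiK S1) (psiK S2) =
    psiK (iota_op (Njoin m n) S1 \o iota_op (Njoin m n) S2).

Definition CNP_covariant : Prop :=
  nica_covariant /\
  forall (F : {fset Nsum k}) (S : forall p, X p -> X p),
    (forall p, (p \in F)%fset -> compact_op (S p)) ->
    holds_for_large (fun q =>
      forall r, \sum_(p <- F) iota_tilde q (S p) r = 0) ->
    \sum_(p <- F) psiK (S p) = 0.

Definition rep_core : set B :=
  closure (linear_span
    [set b | exists n (x y : X n), b = cmul (psi x) (cstar (psi y))]).

(* kappa_tilde n f: on Ctilde n, f is the map kappa~_n^psi *)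
Definition kappa_tilde n (f : opfamily -> B) : Prop :=
  forall S, compact_upto n S ->
    f (tilde_elt n S) = \sum_(p \in [set p | Nle p n]) psiK (S p).

(* kap is the *-homomorphism to the core induced on the inductive limit by
   the maps kappa~_n^psi *)
Definition is_limit_kappa (L : cstarAlgType R) (lam : Nsum k -> opfamily -> L)
    (kap : L -> B) : Prop :=
  [/\ star_hom kap, forall x, rep_core (kap x) &
      forall n, kappa_tilde n (kap \o lam n)].

End Representation.
End ProductSystem.

(* Main.v *)
(* Everything takes place inside [B], where the fibres [X_n] sit isometrically.  A compact
   operator [S] on [X_p] is the same as an element [b] of [K_p], the closed span of
   [psi_p(x) psi_p(y)^*], with [iota_p^r(S)] the multiplication by [b] on [psi_r(X_r)].  If
   [z] is in [X_r I_(q-r)] and [p <= q], [p] not [<= r], then [b psi_r(z) = 0] by Nica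
   covariance, so the family of [S_p], [p <= n], in [C~_n] is the multiplication by the
   single element [sum_p psi^(p)(S_p)] of [B_n = sum_(p <= n) K_p]; this makes kappa~_n
   injective.  By induction on the number of summands, [B_n] is closed, being the sum of a
   C*-algebra and a closed ideal.  Hence the *-homomorphism [B_n -> L] inverse to kappa~ is
   contractive, so that kappa~ is isometric on the image of each [C~_n], and these images are
   dense in [L] by the universal property.

   Two C*-algebraic facts are obtained without functional calculus.  If [|a| < 1] is
   self-adjoint, [a + i (1 - a^2)^(1/2)] is unitary, so *-homomorphisms are contractive.  By
   the same token [|sin (3 arcsin a)| <= 1], and iterating the polynomial [3 a - 4 a^3], which
   is a multiple of the identity up to third order, turns a representative of a class modulo
   an ideal into one whose norm is controlled by the norm of the class. *)
Require Import Defs.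
From HB Require Import structures.
From mathcomp Require Import all_boot all_order all_algebra finmap.
From mathcomp Require Import complex.
From mathcomp Require Import all_classical all_reals all_analysis.
From mathcomp Require Import ring lra.

Set Implicit Arguments.
Unset Strict Implicit.
Unset Printing Implicit Defensive.

Import Order.TTheory GRing.Theory Num.Theory.
Import numFieldNormedType.Exports.

Local Open Scope ring_scope.

Local Notation "a ** b" := (cmul a b) (at level 40, left associativity).

(** * Real-valued norms and completeness *)

Lemma subrACA (V : zmodType) (x u p v : V) : x - u - (p - v) = x - p - (u - v).
Proof. by rewrite !opprB addrACA [RHS]addrACA (addrC (- u)). Qed.

Section RealNorm.
Context (R : realType) (V : normedModType R[i]).
Implicit Types x y z : V.

(** Norms take values in [R[i]]; their real part brings estimates into the ordered field [R], where
    [lra] applies. *)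
Definition nm x : R := complex.Re `|x|.

Lemma nmE x : `|x| = (nm x)%:C%C.
Proof. by rewrite /nm RRe_real // normr_real. Qed.

Lemma nm_ge0 x : 0 <= nm x.
Proof. by rewrite -lecR -nmE normr_ge0. Qed.

Lemma nm0 : nm 0 = 0.
Proof. by rewrite /nm normr0. Qed.

Lemma nm0_eq0 x : nm x <= 0 -> x = 0.
Proof.
move=> h; apply/normr0_eq0; rewrite nmE; congr (_%:C)%C.
by apply/eqP; rewrite eq_le h nm_ge0.
Qed.

Lemma nmD x y : nm (x + y) <= nm x + nm y.
Proof. by rewrite -lecR rmorphD /= -!nmE ler_normD. Qed.

Lemma nmN x : nm (- x) = nm x.
Proof. by rewrite /nm normrN. Qed.

Lemma nmBC x y : nm (x - y) = nm (y - x).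
Proof. by rewrite -nmN opprB. Qed.

Lemma nmB x y : nm (x - y) <= nm x + nm y.
Proof. by rewrite -(nmN y) nmD. Qed.

Lemma nm_tri z x y : nm (x - y) <= nm (x - z) + nm (z - y).
Proof. by rewrite -(subrKA z x (- y)) nmD. Qed.

Lemma nmBr x y : nm x <= nm y + nm (x - y).
Proof. by rewrite -[in leLHS](subrKC y x) nmD. Qed.

Lemma nmZ (r : R) x : nm ((r%:C)%C *: x) = `|r| * nm x.
Proof.
by rewrite /nm normrZ (nmE x) normc_def /= expr0n addr0 sqrtr_sqr mul0r subr0.
Qed.

Lemma nmZc (c : R[i]) x : nm (c *: x) = complex.Re `|c| * nm x.
Proof. by rewrite /nm normrZ (nmE x) normc_def /= mul0r subr0. Qed.

Lemma scaleAc (a b : R[i]) x : a *: (b *: x) = (a * b) *: x.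
Proof. exact: scalerA. Qed.

Lemma scale_half x : (2^-1%:C)%C *: (x + x) = x.
Proof.
rewrite scalerDr -scalerDl -rmorphD /= -[RHS]scale1r; congr (_ *: _).
by rewrite -[RHS](rmorph1 (real_complex R)) /=; congr (_%:C)%C; field.
Qed.

Lemma nm_lin0 x : (forall e : R, 0 < e -> nm x <= e) -> x = 0.
Proof.
by move=> h; apply: nm0_eq0; apply/ler_addgt0Pr => e /h; rewrite add0r.
Qed.

Lemma nm_le (x : V) (e : R) : (nm x <= e) = (`|x| <= (e%:C)%C).
Proof. by rewrite nmE lecR. Qed.

End RealNorm.

Section Closedness.
Context (R : realType) (V : normedModType R[i]).
Implicit Types (M : set V) (x : V).

(** An epsilon form of the closure in terms of [nm]; [nclE] matches it with the topological
    [closure] in [is_tensor] and [rep_core]. *)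
Definition ncl M : set V :=
  [set x | forall e : R, 0 < e -> exists2 y, M y & nm (x - y) <= e]%classic.

Definition nclosed M : Prop := forall x, ncl M x -> M x.

Lemma nclE M : ncl M = closure M.
Proof.
apply/seteqP; split => x /=.
- move=> h U /nbhs_ballP [e /= e0 hU].
  have er : e = (complex.Re e)%:C%C by rewrite RRe_real // gtr0_real.
  have e0' : 0 < complex.Re e by rewrite -ltcR -er.
  have [y My hy] := h (complex.Re e / 2) (divr_gt0 e0' (ltr0n _ 2)).
  exists y; split => //; apply: hU; rewrite -ball_normE /=.
  rewrite nmE er ltcR; apply: (le_lt_trans hy).
  by rewrite ltr_pdivrMr // ltr_pMr // ltr1n.
- move=> h e e0.
  have e0' : 0 < e%:C%C by rewrite ltcR.
  have [y [My]] := h _ (nbhsx_ballx x _ e0').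
  by rewrite -ball_normE /= nmE ltcR => hy; exists y => //; apply: ltW.
Qed.

Lemma sub_ncl M x : M x -> ncl M x.
Proof. by move=> Mx e e0; exists x => //; rewrite subrr nm0 ltW. Qed.

Lemma ncl_ncl M : nclosed (ncl M).
Proof.
move=> x h e e0.
have e2 : 0 < e / 2 by rewrite divr_gt0.
have [y hy1 hy2] := h _ e2; have [z hz1 hz2] := hy1 _ e2.
exists z => //; apply: (le_trans (nm_tri y _ _)); lra.
Qed.

End Closedness.

Lemma geometric_small (R : realType) (C r e : R) : 0 <= r < 1 -> 0 < e ->
  exists N, forall n, (N <= n)%N -> C * r ^+ n <= e.
Proof.
move=> /andP[r0 r1] e0.
have : ((fun n => C * r ^+ n : R) @ \oo --> (C * 0 : R))%classic.
  by apply: cvgM; [exact: cvg_cst|apply: cvg_expr; rewrite ger0_norm].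
rewrite mulr0 => /cvgr_lt /(_ _ e0) [N _ hN].
by exists N => n /hN /ltW.
Qed.

(** The form in which completeness serves the iterations below: increments of geometric size give a
    limit together with an explicit rate. *)
Lemma nm_rapid_cauchy (R : realType) (V : completeNormedModType R[i])
    (u : nat -> V) (C r : R) : 0 <= r < 1 ->
  (forall n, nm (u n.+1 - u n) <= C * r ^+ n) ->
  exists l : V, forall n, nm (u n - l) <= C / (1 - r) * r ^+ n.
Proof.
move=> /andP[r0 r1] hu.
have r1' : 1 - r != 0 by rewrite subr_eq0 eq_sym lt_eqF.
have C0 : 0 <= C.
  by have := hu 0%N; rewrite expr0 mulr1; apply/le_trans/nm_ge0.
have hp n : 0 <= r ^+ n by rewrite exprn_ge0.
have C1 : 0 <= C / (1 - r) by rewrite divr_ge0 // subr_ge0 ltW.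
(* The partial geometric sum is kept exactly, with its term [- r ^+ (n + d)], so that the induction
   closes. *)
have hd n d : nm (u (n + d)%N - u n) <= C / (1 - r) * (r ^+ n - r ^+ (n + d)).
  elim: d => [|d IH]; first by rewrite addn0 !subrr nm0 mulr0.
  rewrite addnS; apply: (le_trans (nm_tri (u (n + d)%N) _ _)).
  apply: (le_trans (lerD (hu _) IH)); rewrite exprS.
  move: (r ^+ (n + d)) (r ^+ n) => a b.
  by rewrite le_eqVlt; apply/orP; left; apply/eqP; field.
have hC : cvg (u @ \oo)%classic.
  apply/cauchy_cvgP/cauchy_ballP => e e0; near_simpl.
  have er : e = (complex.Re e)%:C%C by rewrite RRe_real // gtr0_real.
  have e0' : 0 < complex.Re e by rewrite -ltcR -er.
  have r01 : 0 <= r < 1 by rewrite r0.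
  have e2 : 0 < complex.Re e / 2 by rewrite divr_gt0.
  have [N hN] := geometric_small (2 * (C / (1 - r))) r01 e2.
  have hN' n : (N <= n)%N -> nm (u n - u N) <= C / (1 - r) * r ^+ N.
    move=> /subnKC <-; apply: (le_trans (hd _ _)).
    by rewrite ler_wpM2l // gerBl.
  exists ([set n | (N <= n)%N], [set n | (N <= n)%N])%classic.
    by split; exists N.
  move=> [m n] /= [hm hn]; rewrite -ball_normE /= nmE er ltcR.
  apply: (le_lt_trans (nm_tri (u N) _ _)); rewrite (nmBC (u N)).
  apply: le_lt_trans (_ : _ <= complex.Re e / 2) _; last lra.
  apply: le_trans (hN N _) => //=.
  apply: (le_trans (lerD (hN' _ hm) (hN' _ hn))).
  by rewrite le_eqVlt; apply/orP; left; apply/eqP; ring.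
exists (lim (u @ \oo)%classic) => n.
apply/ler_addgt0Pr => e e0.
have /cvgr_dist_lt /(_ e%:C%C) := hC.
rewrite ltcR => /(_ e0) [N _ hN].
have := hN (maxn n N) (leq_maxr _ _); rewrite /= nmE ltcR => h1.
have hm : maxn n N = (n + (maxn n N - n))%N by rewrite subnKC // leq_maxl.
have := hd n (maxn n N - n)%N; rewrite -hm => h2.
apply: (le_trans (nm_tri (u (maxn n N)) _ _)).
rewrite nmBC (nmBC _ (lim _)); apply: lerD; last exact: ltW.
apply: (le_trans h2); by rewrite ler_wpM2l // gerBl.
Qed.

(** Removes a multiplicative constant: if [x] exceeded [y], the powers of [x / y] would grow beyond
    any [C]. *)
Lemma expr2n_dominated (R : realType) (x y C : R) : 0 <= x -> 0 <= y ->
  (forall k, x ^+ (2 ^ k) <= C * y ^+ (2 ^ k)) -> x <= y.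
Proof.
move=> x0 y0 h; rewrite leNgt; apply/negP => yx.
have {}x0 : 0 < x by apply: le_lt_trans yx.
have [y00|yn0] := eqVneq y 0.
  have := h 0%N; rewrite y00 !expr1 mulr0; lra.
have yp : 0 < y by rewrite lt_neqAle eq_sym yn0.
pose d := x / y - 1.
have d0 : 0 < d by rewrite subr_gt0 ltr_pdivlMr // mul1r.
(* Bernoulli's inequality. *)
have hb k : 1 + k%:R * d <= (x / y) ^+ k.
  elim: k => [|k IH]; first by rewrite mul0r addr0 expr0.
  rewrite exprSr; have -> : x / y = 1 + d by rewrite /d; ring.
  rewrite -[x / y]/(x / y) in IH.
  have := ler_wpM2r (_ : 0 <= 1 + d) IH.
  have -> : x / y = 1 + d by rewrite /d; ring.
  move=> /(_ _) H; apply: le_trans (H _); last lra.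
  have : 0 <= k%:R * d * d by rewrite !mulr_ge0 // ltW.
  rewrite -natr1; lra.
have [N hN] : exists N : nat, C < N%:R * d.
  exists (Num.truncn (C / d)).+1; rewrite -ltr_pdivrMr //.
  exact: truncnS_gt.
have hNk : (N <= 2 ^ N)%N by apply/ltnW/ltn_expl.
have := h N; rewrite -ler_pdivrMr ?exprn_gt0 // -expr_div_n => h1.
have h2 := hb (2 ^ N)%N.
have : N%:R * d <= (2 ^ N)%:R * d by rewrite ler_wpM2r ?ler_nat // ltW.
lra.
Qed.

Lemma expr2n_unbounded (R : realType) (x : R) : exists m, x <= 2 ^+ m.
Proof.
exists (Num.truncn x).+1; apply: (le_trans (ltW (truncnS_gt x))).
by rewrite -natrX ler_nat ltnW // ltn_expl.
Qed.

(** * C*-algebra basics and square roots *)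

Section CStarBasics.
Context (R : realType) (A : cstarAlgType R).
Implicit Types a b c x y z : A.

Lemma cmul0l a : 0 ** a = 0.
Proof. by have := cmulZl 0 (0 : A) a; rewrite !scale0r. Qed.
Lemma cmul0r a : a ** 0 = 0.
Proof. by have := cmulZr 0 a (0 : A); rewrite !scale0r. Qed.
Lemma cmulNl a b : (- a) ** b = - (a ** b).
Proof. by rewrite -scaleN1r cmulZl scaleN1r. Qed.
Lemma cmulNr a b : a ** (- b) = - (a ** b).
Proof. by rewrite -scaleN1r cmulZr scaleN1r. Qed.
Lemma cmulBl a b c : (a - b) ** c = a ** c - b ** c.
Proof. by rewrite cmulDl cmulNl. Qed.
Lemma cmulBr a b c : a ** (b - c) = a ** b - a ** c.
Proof. by rewrite cmulDr cmulNr. Qed.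
Lemma cstar0 : cstar (0 : A) = 0.
Proof. by have := cstarZ 0 (0 : A); rewrite scale0r rmorph0 scale0r. Qed.
Lemma cstarN a : cstar (- a) = - cstar a.
Proof. by rewrite -scaleN1r cstarZ rmorphN1 scaleN1r. Qed.
Lemma cstarB a b : cstar (a - b) = cstar a - cstar b.
Proof. by rewrite cstarD cstarN. Qed.
Lemma cstarZr (r : R) a : cstar ((r%:C)%C *: a) = (r%:C)%C *: cstar a.
Proof. by rewrite cstarZ conj_Creal // complex_real. Qed.
Lemma cmul_suml (I : Type) (s : seq I) (P : pred I) (F : I -> A) a :
  (\sum_(i <- s | P i) F i) ** a = \sum_(i <- s | P i) (F i ** a).
Proof.
by apply: (big_morph (fun x => x ** a)) => [x y|]; rewrite ?cmulDl ?cmul0l.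
Qed.

Lemma nmM a b : nm (a ** b) <= nm a * nm b.
Proof. by rewrite -lecR rmorphM /= -!nmE cnormM. Qed.

Lemma nm_sstar a : nm (cstar a ** a) = nm a ^+ 2.
Proof.
by apply: complexI; rewrite rmorphXn /= -!nmE cnorm_star.
Qed.

Lemma nm_star a : nm (cstar a) = nm a.
Proof.
suff h b : nm b <= nm (cstar b).
  by apply/eqP; rewrite eq_le h andbT -[in leRHS](cstarK a) h.
have [b0|] := ltP 0 (nm b); last by move/le_trans; apply; apply: nm_ge0.
by rewrite -(ler_pM2r b0) -expr2 -nm_sstar nmM.
Qed.

Lemma nm_starr a : nm (a ** cstar a) = nm a ^+ 2.
Proof. by rewrite -{1}(cstarK a) nm_sstar nm_star. Qed.

Lemma sstar_eq0 a : cstar a ** a = 0 -> a = 0.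
Proof.
move=> h; apply: nm0_eq0; have := nm_sstar a.
by rewrite h nm0 => /esym/eqP; rewrite expf_eq0 /= => /eqP ->.
Qed.

Lemma starr_eq0 a : a ** cstar a = 0 -> a = 0.
Proof.
by rewrite -{1}(cstarK a) => /sstar_eq0 h; rewrite -(cstarK a) h cstar0.
Qed.

Lemma nm_sa_sq a : cstar a = a -> nm (a ** a) = nm a ^+ 2.
Proof. by move=> h; rewrite -nm_sstar h. Qed.

Definition re_part a : A := (2^-1%:C)%C *: (a + cstar a).
Definition im_part a : A := ('i * (2^-1%:C)%C) *: (cstar a - a).

Lemma re_part_sa a : cstar (re_part a) = re_part a.
Proof. by rewrite cstarZr cstarD cstarK addrC. Qed.

Lemma im_part_sa a : cstar (im_part a) = im_part a.
Proof.
rewrite cstarZ rmorphM /= conjCi cstarB cstarK conj_Creal ?complex_real //.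
by rewrite mulNr scaleNr -scalerN opprB.
Qed.

Lemma re_im_part a : a = re_part a + 'i *: im_part a.
Proof.
rewrite /re_part /im_part scaleAc mulrA -expr2 sqrCi mulN1r scaleNr -scalerN opprB -scalerDr.
by rewrite addrACA subrr addr0 scale_half.
Qed.

Lemma re_partB a b : re_part (a - b) = re_part a - re_part b.
Proof. by rewrite /re_part cstarB addrACA -opprD scalerBr. Qed.

Lemma im_partB a b : im_part (a - b) = im_part a - im_part b.
Proof. by rewrite /im_part cstarB subrACA scalerBr. Qed.

Lemma nm_re_part a : nm (re_part a) <= nm a.
Proof.
by rewrite nmZ ger0_norm //; have := nmD a (cstar a); rewrite nm_star; lra.
Qed.

Lemma nm_im_part a : nm (im_part a) <= nm a.
Proof.
rewrite /im_part -scaleAc nmZc normCi /= mul1r nmZ ger0_norm //.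
by have := nmB (cstar a) a; rewrite nm_star; lra.
Qed.

End CStarBasics.

Section Subalgebra.
Context (R : realType) (A : cstarAlgType R).

Record star_subalg (S : set A) : Prop := {
  star_subalg_lin : forall (c : R[i]) a b, S a -> S b -> S (c *: a + b);
  star_subalg0 : S 0;
  star_subalgM : forall a b, S a -> S b -> S (a ** b);
  star_subalg_star : forall a, S a -> S (cstar a)
}.

Context (S : set A) (hS : star_subalg S).

Lemma star_subalgZ (c : R[i]) a : S a -> S (c *: a).
Proof.
by move=> Sa; rewrite -[c *: a]addr0; apply: star_subalg_lin => //; apply: star_subalg0.
Qed.

Lemma star_subalgD a b : S a -> S b -> S (a + b).
Proof. by move=> Sa Sb; rewrite -[a]scale1r; apply: star_subalg_lin. Qed.

Lemma star_subalgN a : S a -> S (- a).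
Proof. by rewrite -scaleN1r; apply: star_subalgZ. Qed.

Lemma star_subalgB a b : S a -> S b -> S (a - b).
Proof. by move=> Sa /star_subalgN; apply: star_subalgD. Qed.

Lemma star_subalg_re a : S a -> S (re_part a).
Proof.
by move=> Sa; apply: star_subalgZ; apply: star_subalgD => //; apply: star_subalg_star.
Qed.

Lemma star_subalg_im a : S a -> S (im_part a).
Proof.
by move=> Sa; apply: star_subalgZ; apply: star_subalgB => //; apply: star_subalg_star.
Qed.

End Subalgebra.

Lemma star_subalgT (R : realType) (A : cstarAlgType R) : star_subalg [set: A]%classic.
Proof. by split. Qed.

Lemma nclosedT (R : realType) (A : normedModType R[i]) : nclosed [set: A]%classic.
Proof. by []. Qed.

(** * Square roots of 1 - a^2 without a unit *)

Section SquareRoot.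
Context (R : realType) (A : cstarAlgType R).
Context (S : set A) (hS : star_subalg S) (clS : nclosed S).
Context (a : A) (Sa : S a) (sa_a : cstar a = a) (a1 : nm a < 1).

(** A fixed point satisfies (1 - d)^2 = 1 - a^2, so d is 1 - (1 - a^2)^(1/2). The iterates are
    polynomials in [a] without constant term, hence remain in [S] even if there is no unit. *)
Let step (d : A) : A := (2^-1%:C)%C *: (a ** a + d ** d).
Let u n := iter n step 0.

Let u_inv n :
  [/\ S (u n), cstar (u n) = u n, a ** u n = u n ** a & nm (u n) <= nm a].
Proof.
elim: n => [|n [h1 h2 h3 h4]].
  split; rewrite /u /=; first exact: star_subalg0.
  - by rewrite cstar0.
  - by rewrite cmul0l cmul0r.
  - by rewrite nm0 nm_ge0.
rewrite [u n.+1]/= -/(u n) /step; split.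
- by apply: star_subalgZ => //; apply: star_subalgD => //; apply: star_subalgM.
- by rewrite cstarZr cstarD !cstarM h2 sa_a.
- by rewrite cmulZl cmulZr cmulDl cmulDr !cmulA h3 -!cmulA h3.
- rewrite nmZ ger0_norm //.
  have := nmD (a ** a) (u n ** u n); have := nmM a a; have := nmM (u n) (u n).
  have := ler_pM (nm_ge0 _) (nm_ge0 _) h4 h4.
  have := ler_piMr (nm_ge0 a) (ltW a1).
  lra.
Qed.

Lemma sqrt_one_sub_sq : exists d : A,
  [/\ S d, cstar d = d, a ** d = d ** a & d + d = a ** a + d ** d].
Proof.
have hu n : nm (u n.+1 - u n) <= 1 * nm a ^+ n.
  rewrite mul1r; elim: n => [|n IH].
    have [_ _ _] := u_inv 1; rewrite expr0 {2}/u /= subr0 => h.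
    by apply: (le_trans h); apply: ltW.
  (* x^2 - y^2 = x (x - y) + (x - y) y holds without commutation. As [x] and [y] have norm at most
     [nm a], the increments contract by the factor [nm a]. *)
  have -> : u n.+2 - u n.+1 =
      (2^-1%:C)%C *: (u n.+1 ** (u n.+1 - u n) + (u n.+1 - u n) ** u n).
    rewrite [u n.+2]/= -/(u n.+1) {2}/u iterS -/(u n) /step -scalerBr.
    by rewrite cmulBr cmulBl subrKA opprD addrACA subrr add0r.
  rewrite nmZ ger0_norm //.
  have [_ _ _ h1] := u_inv n; have [_ _ _ h2] := u_inv n.+1.
  have h3 := nmD (u n.+1 ** (u n.+1 - u n)) ((u n.+1 - u n) ** u n).
  have h4 := nmM (u n.+1) (u n.+1 - u n).
  have h5 := nmM (u n.+1 - u n) (u n).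
  have h6 := nm_ge0 (u n.+1 - u n).
  rewrite exprS; have := nm_ge0 a => a0.
  have := ler_wpM2r h6 h1; have := ler_wpM2r h6 h2.
  have := ler_wpM2l a0 IH.
  lra.
have ha : 0 <= nm a < 1 by rewrite nm_ge0.
have [d hd] := nm_rapid_cauchy ha hu.
have hlarge (e : R) : 0 < e -> exists n, nm (u n - d) <= e /\ nm (u n.+1 - d) <= e.
  move=> e0; have [N hN] := geometric_small (1 / (1 - nm a)) ha e0.
  by exists N; split; apply: (le_trans (hd _)); apply: hN.
have hsmall (e : R) : 0 < e -> exists n, nm (u n - d) <= e.
  by move=> /hlarge [n [hn _]]; exists n.
have dn : nm d <= 1.
  apply/ler_addgt0Pr => e /hsmall [n hn].
  have [_ _ _ h4] := u_inv n; have := nmBr d (u n); rewrite nmBC; lra.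
exists d; split.
- by apply: clS => e /hsmall [n hn]; exists (u n); [case: (u_inv n)|rewrite nmBC].
- apply/eqP; rewrite -subr_eq0; apply/eqP/nm_lin0 => e e0.
  have [n hn] := hsmall (e / 2) (divr_gt0 e0 (ltr0n _ 2)).
  have [_ h2 _ _] := u_inv n.
  apply: (le_trans (nm_tri (u n) _ _)).
  by rewrite -{1}h2 -cstarB nm_star (nmBC d); lra.
- apply/eqP; rewrite -subr_eq0; apply/eqP/nm_lin0 => e e0.
  have [n hn] := hsmall (e / 2) (divr_gt0 e0 (ltr0n _ 2)).
  have [_ _ h3 _] := u_inv n.
  apply: (le_trans (nm_tri (a ** u n) _ _)); rewrite {2}h3 -cmulBl -cmulBr.
  have := nmM a (d - u n); have := nmM (u n - d) a; rewrite (nmBC d).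
  have h6 := nm_ge0 (u n - d).
  have := ler_piMl h6 (ltW a1); have := ler_piMr h6 (ltW a1); lra.
(* The fixed point equation passes to the limit by the same factorization of a difference of
   squares. *)
- suff hd' : d = step d.
    by rewrite {1 2}hd' /step -scalerDr scale_half.
  apply/eqP; rewrite -subr_eq0; apply/eqP/nm_lin0 => e e0.
  have [n [hn hn']] := hlarge (e / 2) (divr_gt0 e0 (ltr0n _ 2)).
  apply: (le_trans (nm_tri (u n.+1) _ _)).
  have -> : u n.+1 - step d =
      (2^-1%:C)%C *: (u n ** (u n - d) + (u n - d) ** d).
    rewrite [u n.+1]/= -/(u n) /step -scalerBr.
    by rewrite cmulBl cmulBr subrKA opprD addrACA subrr add0r.
  rewrite nmZ ger0_norm // nmBC.
  have [_ _ _ h4] := u_inv n.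
  have h6 := nm_ge0 (u n - d).
  have h3 := nmD (u n ** (u n - d)) ((u n - d) ** d).
  have h5 := nmM (u n) (u n - d); have h7 := nmM (u n - d) d.
  have h8 := ler_wpM2r h6 h4; have h9 := ler_wpM2l h6 dn.
  have h10 := ler_piMl h6 (ltW a1).
  lra.
Qed.

End SquareRoot.

(** * Contractivity of *-homomorphisms *)

Section Unitary.
Context (R : realType) (A : cstarAlgType R).
Context (a d : A) (sa_a : cstar a = a) (sa_d : cstar d = d).
Context (cad : a ** d = d ** a) (had : d + d = a ** a + d ** d).

(* [U s], [s = 1] or [-1], is the multiplication by [a + s i (1 - d)], which is unitary in
   the unitization because [a^2 + (1 - d)^2 = 1]. *)
Let U (s : R[i]) (z : A) : A := a ** z + (s * 'i) *: (z - d ** z).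

Let T (z : A) : A := a ** z + a ** z.

Let UU (s : R[i]) z : s * s = 1 -> U (- s) (U s z) = z.
Proof.
move=> hs; pose w := z - d ** z.
have aw : a ** w = a ** z - d ** (a ** z) by rewrite cmulBr !cmulA cad.
have h : d ** z + d ** z = a ** (a ** z) + d ** (d ** z).
  by rewrite !cmulA -!cmulDl had.
have dw : w - d ** w = z - a ** (a ** z).
  by rewrite cmulBr opprB addrACA -opprD h opprD addrACA subrr addr0.
have e1 : U s z - d ** U s z = a ** w + (s * 'i) *: (z - a ** (a ** z)).
  by rewrite /U -/w cmulDr cmulZr opprD addrACA aw -dw -scalerBr.
rewrite {1}/U e1 [in a ** _]/U -/w cmulDr cmulZr scalerDr scaleAc mulNr scaleNr.
have -> : - (s * 'i) * (s * 'i) = 1 :> R[i].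
  by rewrite mulNr mulrACA hs -expr2 sqrCi mul1r opprK.
by rewrite scale1r addrA addrK subrKC.
Qed.

(** The adjoint of [U s] is [U (- s)], its inverse by [UU]; the C*-identity then makes [U s]
    isometric. *)
Let nmU (s : R[i]) z : s * s = 1 -> Num.conj s = s -> nm (U s z) = nm z.
Proof.
move=> s1 s2; apply/eqP; rewrite -(@eqrXn2 _ 2) ?nm_ge0 // -!nm_sstar.
suff H y : cstar (U s z) ** y = cstar z ** U (- s) y by rewrite H UU.
rewrite {1}/U cstarD cstarZ rmorphM /= conjCi s2 mulrN -mulNr cstarB !cstarM sa_a sa_d.
by rewrite /U cmulDr cmulZr cmulBr cmulDl cmulZl cmulBl !cmulA.
Qed.

Let UT z : U 1 z + U (-1) z = T z.
Proof. by rewrite /U addrACA mulNr scaleNr subrr addr0. Qed.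

(** With u + u^* = 2 a and u^* u = 1 this is u^2 = 2 a u - 1, the recurrence that reduces u^3 in
    [unitary_triple]. *)
Let U2 (s : R[i]) z : s * s = 1 -> (forall y, U s y + U (- s) y = T y) ->
  U s (U s z) = T (U s z) - z.
Proof. by move=> hs hT; rewrite -hT UU // addrK. Qed.

Let N11 : (-1) * (-1) = 1 :> R[i]. Proof. by rewrite mulrNN mulr1. Qed.
Let c1 : Num.conj 1 = 1 :> R[i]. Proof. exact: rmorph1. Qed.
Let cN1 : Num.conj (- 1) = - 1 :> R[i]. Proof. exact: rmorphN1. Qed.

Let UT' z : U (-1) z + U (- -1) z = T z.
Proof. by rewrite opprK addrC UT. Qed.

(** Multiplication by [a] is the average of the isometries [U 1] and [U (-1)]. *)
Lemma unitary_contr z : nm (a ** z) <= nm z.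
Proof.
rewrite -(scale_half (a ** z)) nmZ ger0_norm // -/(T z) -UT.
have := nmD (U 1 z) (U (- 1) z); rewrite !nmU ?mulr1 //; lra.
Qed.

(* [u^3 + (u^* )^3 = 8 a^3 - 6 a] when [u + u^* = 2 a] and [u u^* = 1]. *)
Lemma unitary_triple z :
  nm (a ** z + a ** z + a ** z - (4%:R : R[i]) *: (a ** (a ** (a ** z)))) <= nm z.
Proof.
have TD x y : T (x + y) = T x + T y by rewrite /T !cmulDr addrACA.
have TN x : T (- x) = - T x by rewrite /T !cmulNr opprD.
have h1 : U 1 (U 1 (U 1 z)) = T (U 1 (U 1 z)) - U 1 z.
  by apply: U2 => //; rewrite mulr1.
have h2 : U (-1) (U (-1) (U (-1) z)) = T (U (-1) (U (-1) z)) - U (-1) z.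
  by apply: U2 N11 UT'.
have h3 : U 1 (U 1 (U 1 z)) + U (-1) (U (-1) (U (-1) z)) = T (T (T z) - (z + z)) - T z.
  rewrite h1 h2 addrACA -opprD UT -TD; congr (T _ - _).
  by rewrite (U2 z (mulr1 1) UT) (U2 z N11 UT') addrACA -TD UT -opprD.
have -> : a ** z + a ** z + a ** z - (4%:R : R[i]) *: (a ** (a ** (a ** z))) =
    - ((2^-1%:C)%C *: (U 1 (U 1 (U 1 z)) + U (-1) (U (-1) (U (-1) z)))).
  have TE y : T y = (2%:R : R[i]) *: (a ** y) by rewrite scaler_nat mulr2n.
  have hT y : (2^-1%:C)%C *: T y = a ** y by apply: scale_half.
  rewrite h3 (TD _ (- (z + z))) TN (TD z z) -[_ - _ - T z]addrA -opprD.
  rewrite scalerBr opprB !(scalerDr _ _ (T z)) !hT.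
  by congr (_ - _); rewrite !TE !cmulZr scaleAc -natrM.
rewrite nmN nmZ ger0_norm //.
have := nmD (U 1 (U 1 (U 1 z))) (U (-1) (U (-1) (U (-1) z))).
rewrite !nmU ?mulr1 //; lra.
Qed.

End Unitary.

(** Relative to a subset, because sources such as [core_part] are subsets of [B] rather than
    types. *)
Record star_hom_on (R : realType) (A B : cstarAlgType R) (S : set A) (f : A -> B)
    : Prop := {
  star_hom_on_lin : forall (c : R[i]) a b, S a -> S b ->
    f (c *: a + b) = c *: f a + f b;
  star_hom_onM : forall a b, S a -> S b -> f (a ** b) = f a ** f b;
  star_hom_on_star : forall a, S a -> f (cstar a) = cstar (f a)
}.

Section StarHom.
Context (R : realType) (A B : cstarAlgType R).
Context (S : set A) (hS : star_subalg S) (f : A -> B) (hf : star_hom_on S f).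

Lemma star_hom_on0 : f 0 = 0.
Proof.
have h0 := star_subalg0 hS.
have := star_hom_on_lin hf 0 h0 h0; rewrite !scale0r !add0r => h.
by have := star_hom_on_lin hf 1 h0 h0; rewrite !scale1r addr0 -{1}[f 0]addr0 => /addrI.
Qed.

Lemma star_hom_onZ (c : R[i]) a : S a -> f (c *: a) = c *: f a.
Proof.
move=> Sa; have := star_hom_on_lin hf c Sa (star_subalg0 hS).
by rewrite star_hom_on0 !addr0.
Qed.

Lemma star_hom_onD a b : S a -> S b -> f (a + b) = f a + f b.
Proof. by move=> Sa Sb; have := star_hom_on_lin hf 1 Sa Sb; rewrite !scale1r. Qed.

Lemma star_hom_onB a b : S a -> S b -> f (a - b) = f a - f b.
Proof.
move=> Sa Sb; rewrite -(scaleN1r b) -(scaleN1r (f b)) star_hom_onD ?star_hom_onZ //.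
exact: star_subalgZ.
Qed.

Context (clS : nclosed S).

(** The relations between [b] and the [d] of [sqrt_one_sub_sq] are algebraic, so [f] preserves them
    and [f b] is again the average of two unitaries. The general case follows by passing to a^*
    a. *)
Lemma star_hom_contr a : S a -> nm (f a) <= nm a.
Proof.
have h1 b : S b -> cstar b = b -> nm b < 1 -> nm (f b) <= 1.
  move=> Sb sb b1; have [d [Sd sd cd hd]] := sqrt_one_sub_sq hS clS Sb sb b1.
  have fs : cstar (f b) = f b by rewrite -(star_hom_on_star hf) // sb.
  (* Contractivity of the multiplication by [f b], applied to [f b] itself: the square of its norm
     is at most its norm. *)
  have : nm (f b ** f b) <= nm (f b).
    apply: (@unitary_contr _ _ _ (f d)) => //.
    - by rewrite -(star_hom_on_star hf) // sd.
    - by rewrite -!(star_hom_onM hf) // cd.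
    - rewrite -!(star_hom_onM hf) // -!star_hom_onD //; try exact: star_subalgM.
      by rewrite hd.
  rewrite nm_sa_sq //; have := nm_ge0 (f b); nra.
have h2 b : S b -> cstar b = b -> nm (f b) <= nm b.
  move=> Sb sb; apply/ler_addgt0Pr => e e0.
  have p : 0 < nm b + e by have := nm_ge0 b; lra.
  (* Dividing by [nm b + e] brings the norm strictly below 1, as [h1] requires. *)
  have := h1 (((nm b + e)^-1%:C)%C *: b).
  rewrite cstarZr sb star_hom_onZ // !nmZ ger0_norm ?invr_ge0 ?(ltW p) //.
  rewrite !(mulrC _^-1) ltr_pdivrMr // ler_pdivrMr // !mul1r; apply => //.
    exact: star_subalgZ.
  by rewrite ltrDl.
move=> Sa; rewrite -(@ler_pXn2r _ 2) ?nnegrE ?nm_ge0 // -!nm_sstar.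
have Ss := star_subalg_star hS Sa.
rewrite -(star_hom_on_star hf) // -(star_hom_onM hf) //.
by apply: h2; [exact: star_subalgM|rewrite cstarM cstarK].
Qed.

End StarHom.

Section Tripling.
Context (R : realType) (A : cstarAlgType R).

Definition cube (a : A) := a ** (a ** a).

Lemma nm_cube a : nm (cube a) <= nm a ^+ 3.
Proof.
apply: (le_trans (nmM _ _)); rewrite exprS ler_wpM2l ?nm_ge0 //.
by apply: (le_trans (nmM _ _)); rewrite expr2.
Qed.

(* [sin (3 x) = 3 sin x - 4 (sin x)^3] *)
Lemma nm_triple (a : A) (M : R) : cstar a = a -> nm a < M ->
  nm (a - ((4 / (3 * M ^+ 2))%:C)%C *: cube a) <= M / 3.
Proof.
move=> sa aM; have M0 : 0 < M := le_lt_trans (nm_ge0 _) aM.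
pose b := (M^-1%:C)%C *: a.
have sb : cstar b = b by rewrite cstarZr sa.
have b1 : nm b < 1.
  by rewrite nmZ ger0_norm ?invr_ge0 ?ltW // mulrC ltr_pdivrMr // mul1r.
pose q := b + b + b - (4%:R : R[i]) *: cube b.
have sq : cstar q = q.
  by rewrite /q /cube cstarB !cstarD (cstarZ 4%:R) rmorph_nat !cstarM !sb cmulA.
have [d [_ sd cd hd]] := sqrt_one_sub_sq (star_subalgT A) (@nclosedT _ A) I sb b1.
(* [unitary_triple] bounds the multiplication by [q]; it is applied to the vector [q]. *)
have : nm (q ** q) <= nm q.
  have := unitary_triple sb sd cd hd q.
  suff -> : q ** q = b ** q + b ** q + b ** q -
    (4%:R : R[i]) *: (b ** (b ** (b ** q))) by [].
  by rewrite {1}/q cmulBl !cmulDl (cmulZl 4%:R) /cube -!cmulA.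
rewrite nm_sa_sq // => h.
have {h} : nm q <= 1 by have := nm_ge0 q; nra.
(* The factor M / 3 normalizes the linear coefficient of 3 b - 4 b^3, with b = a / M, to 1. *)
have -> : a - ((4 / (3 * M ^+ 2))%:C)%C *: cube a = ((M / 3)%:C)%C *: q.
  have cb : cube b = (M^-1%:C * (M^-1%:C * M^-1%:C))%C *: cube a.
    by rewrite /cube !(cmulZl, cmulZr) !scaleAc mulrA.
  have b3 : b + b + b = ((3%:R : R)%:C)%C *: b.
    by rewrite rmorph_nat scaler_nat !mulrS mulr0n addr0 addrA.
  rewrite /q scalerBr b3 cb !scaleAc -(rmorph_nat (real_complex R)) -!rmorphM /=.
  have -> : M / 3 * 3 / M = 1 by field; rewrite gt_eqF.
  rewrite scale1r; congr (_ - (_%:C)%C *: _); field.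
  by rewrite gt_eqF.
rewrite nmZ ger0_norm ?divr_ge0 ?(ltW M0) // => h.
by apply: ler_piMr => //; rewrite divr_ge0 // ltW.
Qed.

End Tripling.

(** * Ideals, isometry and closed sums *)

Section Reduction.
Context (R : realType) (A B : cstarAlgType R).
Context (S : set A) (hS : star_subalg S) (clS : nclosed S).
Context (f : A -> B) (hf : star_hom_on S f).
Context (J : set B) (clJ : nclosed J).
Context (Jlin : forall (c : R[i]) x y, J x -> J y -> J (c *: x + y)) (J0 : J 0).
Context (JM : forall x y, J x -> J y -> J (x ** y)).
Context (JSl : forall a x, S a -> J x -> J (f a ** x)).
Context (JSr : forall a x, S a -> J x -> J (x ** f a)).

Let JD x y : J x -> J y -> J (x + y).
Proof. by move=> Jx Jy; rewrite -[x]scale1r; apply: Jlin. Qed.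

Let JZ (c : R[i]) x : J x -> J (c *: x).
Proof. by move=> Jx; rewrite -[_ *: _]addr0; apply: Jlin. Qed.

Let JB x y : J x -> J y -> J (x - y).
Proof. by move=> Jx Jy; apply: JD => //; rewrite -scaleN1r; apply: JZ. Qed.

Let Jmul y y' x x' : S x -> S x' -> J (y - f x) -> J (y' - f x') ->
  J (y ** y' - f (x ** x')).
Proof.
move=> Sx Sx' h h'; rewrite (star_hom_onM hf) //.
have -> : y ** y' - f x ** f x' =
    (y - f x) ** (y' - f x') + (y - f x) ** f x' + f x ** (y' - f x').
  by rewrite -cmulDr subrK cmulBl cmulBr subrKA.
by apply: JD; [apply: JD; [exact: JM|exact: JSr]|exact: JSl].
Qed.

Let Jcube y x : S x -> J (y - f x) -> J (cube y - f (cube x)).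
Proof.
by move=> Sx h; apply: (Jmul Sx _ h (Jmul Sx Sx h h)); apply: star_subalgM.
Qed.

(* Tripling halves the bound on [x], but moves [y], whose norm is much smaller,
   only a little. *)
Let reduce_rec (s : B) (t : R) (m : nat) : 0 < t -> nm s <= t ->
  forall M x y, 4 * t <= M -> M <= 8 * t * 2 ^+ m ->
    S x -> cstar x = x -> nm x < M -> J (y - f x) ->
    nm (y - s) <= 3 / 2 * t * (t / M) ^+ 2 ->
  exists x' y', [/\ S x', cstar x' = x', nm x' <= 8 * t, J (y' - f x') &
     nm (y' - s) <= t / 2].
Proof.
move=> t0 hs; elim: m => [|m IH] M x y M1 M2 Sx sx xM hJ hy.
all: have M0 : 0 < M by lra.
all: have q0 : 0 <= t / M <= 1 / 4 by
  apply/andP; split; [rewrite divr_ge0 // ltW //|rewrite ler_pdivrMr //; lra].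
all: have hq : (t / M) ^+ 2 <= 1 / 16 by
  case/andP: q0 => q1 q2; have := ler_pM q1 q1 q2 q2; rewrite -expr2; lra.
all: have hy' : nm (y - s) <= t / 2 by
  have := ler_wpM2l (ltW t0) hq; lra.
  by exists x, y; split=> //; rewrite expr0 mulr1 in M2; lra.
have [M8|M8] := leP M (8 * t).
  by exists x, y; split=> //; lra.
(* The coefficient from [nm_triple]. The same polynomial is applied to [x] and to [y], so they stay
   congruent modulo [J]. *)
pose c := 4 / (3 * M ^+ 2).
apply: (IH (M / 2) (x - (c%:C)%C *: cube x) (y - (c%:C)%C *: cube y)).
- lra.
- by rewrite exprS in M2; lra.
- by apply: star_subalgB => //; apply: star_subalgZ => //; do 2!apply: star_subalgM => //.
- by rewrite cstarB cstarZr !cstarM sx /cube cmulA.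
- by apply: le_lt_trans (nm_triple sx xM) _; lra.
- rewrite (star_hom_onB hS hf) //; last first.
    by apply: star_subalgZ => //; do 2!apply: star_subalgM => //.
  rewrite (star_hom_onZ hS hf) //; last by do 2!apply: star_subalgM => //.
  rewrite subrACA -scalerBr; apply: JB => //.
  by apply: JZ; apply: Jcube.
- have c0 : 0 <= c by rewrite divr_ge0 // mulr_ge0 // sqr_ge0.
  have ny : nm y <= 3 / 2 * t by have := nmBr y s; lra.
  have h3 := ler_pM (nm_ge0 y) (nm_ge0 y) ny ny.
  have h4 := ler_pM (nm_ge0 y) (mulr_ge0 (nm_ge0 y) (nm_ge0 y)) ny h3.
  have h5 := nm_cube y.
  have h6 := nmZ c (cube y); rewrite ger0_norm // in h6.
  have h7 := nm_tri y (y - (c%:C)%C *: cube y) s.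
  have h8 : nm (y - (c%:C)%C *: cube y - y) = c * nm (cube y).
    by rewrite addrC addKr nmN h6.
  have h9 : c * nm (cube y) <= c * (27 / 8 * t ^+ 3).
    by rewrite ler_wpM2l // (le_trans h5) // !exprS expr0 mulr1; lra.
  have h10 : c * (27 / 8 * t ^+ 3) = 9 / 2 * t * (t / M) ^+ 2.
    by rewrite /c; field; rewrite gt_eqF.
  (* Halving [M] raises the allowed drift from 3/2 to 6 times t (t/M)^2; the difference is exactly
     the 9/2 that the cubic term may cost. *)
  have h11 : 3 / 2 * t * (t / (M / 2)) ^+ 2 = 6 * t * (t / M) ^+ 2.
    by field; rewrite gt_eqF.
  by rewrite h11; lra.
Qed.

(** The pair x', y' of [reduce_rec] is split off: x' = a - a' has norm at most 8 t, and y' is so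
    close to [s] that the remainder s' = s - y' obeys half the bound on [s]. *)
Let reduce (a : A) (s : B) (t : R) : 0 < t -> nm s <= t -> S a -> cstar a = a ->
  J (s - f a) -> exists a' s', [/\ S a', cstar a' = a', nm (a - a') <= 8 * t,
    J (s' - f a') & nm s' <= t / 2].
Proof.
move=> t0 hs Sa sa hJ.
have [m hm] : exists m, nm a + 8 * t <= 8 * t * 2 ^+ m.
  have [m hm] := expr2n_unbounded ((nm a + 8 * t) / (8 * t)).
  by exists m; move: hm; rewrite ler_pdivrMr; lra.
(* The start is y = s, without drift; the summand 8 t makes [M] exceed [nm a] strictly and be at
   least 4 t. *)
have [] := @reduce_rec s t m t0 hs (nm a + 8 * t) a s.
- by have := nm_ge0 a; lra.
- by [].
- by [].
- by [].
- lra.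
- by [].
- by rewrite subrr nm0; apply: mulr_ge0; [lra|exact: sqr_ge0].
move=> x' [y' [h1 h2 h3 h4 h5]]; exists (a - x'), (s - y'); split.
- exact: star_subalgB.
- by rewrite cstarB sa h2.
- by rewrite opprB subrKC.
- by rewrite (star_hom_onB hS hf) // subrACA; apply: JB.
- by rewrite nmBC.
Qed.

(** Iterating [reduce], the parts split off sum to at most 8 t + 4 t + ... = 16 t while the
    remainders tend to 0. So the norm of [a] modulo the preimage of [J] is at most 16 times the norm
    of any element congruent to [f a]. *)
Lemma lift_bound (a : A) (s : B) (t : R) : 0 < t -> nm s <= t -> S a ->
  cstar a = a -> J (s - f a) ->
  exists l, [/\ S l, nm (a - l) <= 16 * t & J (f l)].
Proof.
move=> t0 hs Sa sa hJ.
pose P k (p : A * B) := [/\ S p.1, cstar p.1 = p.1, J (p.2 - f p.1) &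
  nm p.2 <= t * 2^-1 ^+ k].
have hr0 k : 0 < t * 2^-1 ^+ k by rewrite mulr_gt0 // exprn_gt0.
have step (kp : nat * (A * B)) : exists q, P kp.1 kp.2 ->
    P kp.1.+1 q /\ nm (kp.2.1 - q.1) <= 8 * (t * 2^-1 ^+ kp.1).
  case: kp => k p /=; have [|nP] := pselect (P k p); last by exists p.
  move=> [h1 h2 h3 h4].
  have [a' [s' [g1 g2 g3 g4 g5]]] := reduce (hr0 k) h4 h1 h2 h3.
  exists (a', s') => _; split => //; split => //=.
  by apply: (le_trans g5); rewrite exprS; lra.
have [F hF] := choice step.
pose u := fix u k := if k is k'.+1 then F (k', u k') else (a, s).
have hu k : P k (u k).
  elim: k => [|k IH]; first by split => //=; rewrite expr0 mulr1.
  by have [] := hF (k, u k) IH.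
have hd k : nm ((u k.+1).1 - (u k).1) <= 8 * t * 2^-1 ^+ k.
  by have [_ /=] := hF (k, u k) (hu k); rewrite nmBC mulrA.
have half : 0 <= (2^-1 : R) < 1 by apply/andP; split; lra.
have h16 : 8 * t / (1 - 2^-1) = 16 * t by field.
have [l] := nm_rapid_cauchy half hd; rewrite h16 => hl.
have Sl : S l.
  apply: clS => e e0.
  have [N hN] := geometric_small (16 * t) half e0.
  exists (u N).1; first by case: (hu N).
  by rewrite nmBC; apply: (le_trans (hl _)); apply: hN.
exists l; split => //.
  by have := hl 0%N; rewrite expr0 mulr1.
(* 0 - f l is the limit of the elements s_k - f a_k of [J], since s_k tends to 0 and [f] is
   contractive. *)
have -> : f l = - 1 *: (0 - f l) by rewrite sub0r scaleN1r opprK.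
apply: JZ; apply: clJ => e e0.
have e2 : 0 < e / 2 by lra.
have [N hN] := geometric_small (16 * t) half e2.
have [N' hN'] := geometric_small t half e2.
have [h1 h2 h3 h4] := hu (maxn N N').
exists ((u (maxn N N')).2 - f (u (maxn N N')).1) => //.
apply: le_trans (_ : nm (u (maxn N N')).2 + nm (f ((u (maxn N N')).1 - l)) <= _).
  rewrite (star_hom_onB hS hf) // subrACA; apply: (le_trans (nmB _ _)).
  by rewrite sub0r nmN (nmBC (f l)).
have := star_hom_contr hS hf clS (star_subalgB hS h1 Sl).
have := hl (maxn N N'); have := hN _ (leq_maxl N N').
have := hN' _ (leq_maxr N N'); lra.
Qed.

End Reduction.

Section Squaring.
Context (R : realType) (A : cstarAlgType R).

Definition square_iter k (a : A) := iter k (fun x => x ** x) a.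

Lemma square_iter_sa k a : cstar a = a -> cstar (square_iter k a) = square_iter k a.
Proof. by move=> sa; elim: k => //= k IH; rewrite cstarM IH. Qed.

Lemma nm_square_iter k a : cstar a = a -> nm (square_iter k a) = nm a ^+ (2 ^ k).
Proof.
move=> sa; elim: k => [|k IH] /=; first by rewrite expr1.
by rewrite nm_sa_sq ?square_iter_sa // IH -exprM expnSr.
Qed.

Lemma square_iter_in (S : set A) k a : star_subalg S -> S a -> S (square_iter k a).
Proof. by move=> hS Sa; elim: k => //= k IH; apply: star_subalgM. Qed.

End Squaring.

(** [lift_bound] with J = 0 gives [nm b <= 16 * nm (f b)] for self-adjoint [b]. Applying this to the
    powers b^(2^k), whose norms are powers of [nm b], removes the 16. *)
Lemma star_hom_isometric (R : realType) (A B : cstarAlgType R) (S : set A)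
    (f : A -> B) : star_subalg S -> nclosed S -> star_hom_on S f ->
  (forall a, S a -> f a = 0 -> a = 0) -> forall a, S a -> nm (f a) = nm a.
Proof.
move=> hS clS hf inj a Sa; apply/eqP; rewrite eq_le (star_hom_contr hS hf) //=.
have h1 b : S b -> cstar b = b -> nm b <= 16 * nm (f b).
  move=> Sb sb; have [n0|n0] := leP (nm (f b)) 0.
    have -> : b = 0 by apply: inj => //; apply: nm0_eq0.
    by rewrite nm0 mulr_ge0 // nm_ge0.
  have [] := @lift_bound _ _ _ S hS clS f hf [set 0]%classic _ _ _ _ _ _ b (f b)
     _ n0 (lexx _) Sb sb.
  - move=> x hx /=; apply: nm_lin0 => e /hx [y -> ]; by rewrite subr0.
  - by move=> c x y -> ->; rewrite scaler0 addr0.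
  - by [].
  - by move=> x y -> _; rewrite cmul0l.
  - by move=> c x _ ->; rewrite cmul0r.
  - by move=> c x _ ->; rewrite cmul0l.
  - by rewrite /= subrr.
  - by move=> l [Sl hl /inj -/(_ Sl) l0]; rewrite l0 subr0 in hl.
have h2 b : S b -> cstar b = b -> nm b <= nm (f b).
  move=> Sb sb; have sfb : cstar (f b) = f b by rewrite -(star_hom_on_star hf) // sb.
  apply: (expr2n_dominated (nm_ge0 _) (nm_ge0 _) (C := 16)) => k.
  rewrite -!nm_square_iter //.
  have -> : square_iter k (f b) = f (square_iter k b).
    elim: k => //= k ->; rewrite (star_hom_onM hf) //; exact: square_iter_in.
  by apply: h1; [exact: square_iter_in|exact: square_iter_sa].
rewrite -(@ler_pXn2r _ 2) ?nnegrE ?nm_ge0 // -!nm_sstar.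
have Ss := star_subalg_star hS Sa.
rewrite -(star_hom_on_star hf) // -(star_hom_onM hf) //.
by apply: h2; [exact: star_subalgM|rewrite cstarM cstarK].
Qed.

(** * The sum of a C*-algebra and a closed ideal *)

Section SumClosed.
Context (R : realType) (B : cstarAlgType R) (S J : set B).
Context (hS : star_subalg S) (clS : nclosed S) (hJ : star_subalg J) (clJ : nclosed J).
Context (hSJ : forall a x, S a -> J x -> J (a ** x)).

Definition sum_set : set B := [set x | exists2 a, S a & J (x - a)]%classic.

Let hJS a x : S a -> J x -> J (x ** a).
Proof.
move=> Sa Jx; rewrite -[_ ** _]cstarK; apply: (star_subalg_star hJ).
by rewrite cstarM; apply: hSJ; apply: star_subalg_star.
Qed.

Lemma sum_set_subalg : star_subalg sum_set.
Proof.
split.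
- move=> c x y [a Sa ha] [b Sb hb]; exists (c *: a + b).
    exact: star_subalg_lin.
  by rewrite opprD addrACA -scalerBr; apply: star_subalg_lin.
- by exists 0; [exact: star_subalg0|rewrite subrr; exact: star_subalg0].
- move=> x y [a Sa ha] [b Sb hb]; exists (a ** b); first exact: star_subalgM.
  have -> : x ** y - a ** b = (x - a) ** (y - b) + (x - a) ** b + a ** (y - b).
    by rewrite -cmulDr subrK cmulBl cmulBr subrKA.
  apply: star_subalgD => //; last exact: hSJ.
  by apply: star_subalgD => //; [exact: star_subalgM|exact: hJS].
- move=> x [a Sa ha]; exists (cstar a); first exact: star_subalg_star.
  by rewrite -cstarB; apply: star_subalg_star.
Qed.

Let id_hom : star_hom_on S (@id B). Proof. by split. Qed.

(** Approximants s_k of [x] have parts a_k in [S] that need not converge. But a_(k+1) - a_k is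
    congruent modulo [J] to the small s_(k+1) - s_k, so [lift_bound] makes it small after
    subtraction of an element of both [S] and [J]. *)
Lemma nclosed_sum_set : nclosed sum_set.
Proof.
have hT := sum_set_subalg.
(* [lift_bound] is about self-adjoint elements; real and imaginary parts reduce to these. *)
suff hsa x : cstar x = x -> ncl sum_set x -> sum_set x.
  move=> x hx; rewrite (re_im_part x) addrC; apply: (star_subalg_lin hT).
    apply: hsa; first exact: im_part_sa.
    move=> e /hx [y hy hxy]; exists (im_part y); first exact: star_subalg_im.
    by rewrite -im_partB (le_trans (nm_im_part _)).
  apply: hsa; first exact: re_part_sa.
  move=> e /hx [y hy hxy]; exists (re_part y); first exact: star_subalg_re.
  by rewrite -re_partB (le_trans (nm_re_part _)).
move=> sx hx.
pose r k : R := 2^-1 ^+ k.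
have r0 k : 0 < r k by rewrite exprn_gt0.
have step k : exists p : B * B, [/\ S p.1, cstar p.1 = p.1, J (p.2 - p.1) & nm (x - p.2) <= r k].
  have [y [b Sb hb] hxy] := hx _ (r0 k).
  exists (re_part b, re_part y); split => /=.
  - exact: star_subalg_re.
  - exact: re_part_sa.
  - by rewrite -re_partB; apply: star_subalg_re.
  - have -> : x = re_part x by rewrite /re_part sx scale_half.
    by rewrite -re_partB (le_trans (nm_re_part _)).
have [p hp] := choice step.
pose a k := (p k).1; pose s k := (p k).2.
have lift k : exists l, [/\ S l, nm (a k.+1 - a k - l) <= 32 * r k & J l].
  have [Sa sa Ja ha] := hp k; have [Sa' sa' Ja' ha'] := hp k.+1.
  have [] := @lift_bound _ _ _ S hS clS id id_hom J clJ (star_subalg_lin hJ) (star_subalg0 hJ)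
    (star_subalgM hJ) hSJ hJS (a k.+1 - a k) (s k.+1 - s k) (2 * r k).
  - by rewrite mulr_gt0.
  - apply: (le_trans (nm_tri x _ _)); rewrite nmBC.
    by apply: (le_trans (lerD ha' ha)); rewrite /r exprS; have := r0 k; rewrite /r; lra.
  - exact: star_subalgB.
  - by rewrite cstarB sa sa'.
  - by rewrite /= subrACA; apply: star_subalgB.
  - by move=> l [h1 h2 h3]; exists l; split => //; lra.
have [l hl] := choice lift.
(* a_k with all earlier corrections removed: it differs from a_k by an element of [J], and its
   increments are geometric. *)
pose E := fix E k := if k is k'.+1 then E k' + (a k'.+1 - a k' - l k') else a 0%N.
have hE k : S (E k) /\ J (a k - E k).
  elim: k => [|k [IH1 IH2]] /=.
    by split; [have [] := hp 0%N|rewrite subrr; exact: star_subalg0].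
  have [h1 h2 h3] := hl k; have [Sa _ _ _] := hp k; have [Sa' _ _ _] := hp k.+1.
  split; first by apply: star_subalgD => //; do 2!apply: star_subalgB => //.
  have -> : a k.+1 - (E k + (a k.+1 - a k - l k)) = (a k - E k) + l k.
    rewrite -{1}(subrK (a k) (a k.+1)) -{1}(subrK (l k) (a k.+1 - a k)).
    move: (a k.+1 - a k - l k) => D.
    by rewrite opprD addrA addrAC -(addrA D) (addrC D) addrK -addrA addrC.
  exact: star_subalgD.
have half : 0 <= (2^-1 : R) < 1 by apply/andP; split; lra.
have hd k : nm (E k.+1 - E k) <= 32 * 2^-1 ^+ k.
  by rewrite /= addrC addKr; have [] := hl k.
have [e he] := nm_rapid_cauchy half hd.
exists e.
  apply: clS => d d0.
  have [N hN] := geometric_small (32 / (1 - 2^-1)) half d0.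
  exists (E N); first by case: (hE N).
  by rewrite nmBC; apply: (le_trans (he _)); apply: hN.
apply: clJ => d d0; have d2 : 0 < d / 2 by lra.
have [N hN] := geometric_small (32 / (1 - 2^-1)) half d2.
have [N' hN'] := geometric_small 1 half d2.
pose n := maxn N N'.
exists (s n - E n).
  have [_ _ h _] := hp n; have [_ h'] := hE n.
  by rewrite -[s n - E n](subrKA (a n)) ; apply: star_subalgD.
rewrite subrACA; apply: (le_trans (nmB _ _)); rewrite (nmBC e).
have [_ _ _ h] := hp n.
have := he n; have := hN _ (leq_maxl N N'); have := hN' _ (leq_maxr N N').
rewrite -/n /s; rewrite /r in h; lra.
Qed.

End SumClosed.

(** * The index semigroup *)

Section Nsum.
Context (k : option nat).
Implicit Types m n p q r : Nsum k.

Lemma Nsum_ext m n : (forall i, m i = n i) -> m = n.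
Proof. by move=> h; apply/fsfunP. Qed.

Lemma NzeroE i : (Nzero : Nsum k) i = 0%N.
Proof. by rewrite fsfunE. Qed.

Lemma NaddE m n i : Nadd m n i = (m i + n i)%N.
Proof.
rewrite fsfunE inE !mem_finsupp.
by case: eqP => [->|_] //=; case: eqP => [->|].
Qed.

Lemma NsubE m n i : Nsub m n i = (m i - n i)%N.
Proof. by rewrite fsfunE mem_finsupp; case: eqP => [->|]. Qed.

Lemma NjoinE m n i : Njoin m n i = maxn (m i) (n i).
Proof.
rewrite fsfunE inE !mem_finsupp.
by case: eqP => [->|_] //=; case: eqP => [->|].
Qed.

Lemma Nle_refl n : Nle n n. Proof. by move=> i. Qed.

Lemma Nle_trans m n p : Nle m n -> Nle n p -> Nle m p.
Proof. by move=> h1 h2 i; apply: leq_trans (h2 i). Qed.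

Lemma Nle_joinl m n : Nle m (Njoin m n).
Proof. by move=> i; rewrite NjoinE leq_maxl. Qed.

Lemma Nle_joinr m n : Nle n (Njoin m n).
Proof. by move=> i; rewrite NjoinE leq_maxr. Qed.

Lemma Njoin_lub m n p : Nle m p -> Nle n p -> Nle (Njoin m n) p.
Proof. by move=> h1 h2 i; rewrite NjoinE geq_max h1 h2. Qed.

Lemma Nadd0n n : Nadd Nzero n = n.
Proof. by apply: Nsum_ext => i; rewrite NaddE NzeroE. Qed.

Lemma Naddn0 n : Nadd n Nzero = n.
Proof. by apply: Nsum_ext => i; rewrite NaddE NzeroE addn0. Qed.

Lemma Naddn_sub m n : Nle m n -> Nadd m (Nsub n m) = n.
Proof. by move=> h; apply: Nsum_ext => i; rewrite NaddE NsubE subnKC. Qed.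

Lemma Nsub_neq0 m n : Nle m n -> m <> n -> Nsub n m <> Nzero.
Proof. by move=> h mn h0; apply: mn; rewrite -(Naddn_sub h) h0 Naddn0. Qed.

Lemma Nle_sub m n p : Nle m n -> Nle (Nsub m p) (Nsub n p).
Proof. by move=> h i; rewrite !NsubE leq_sub2r. Qed.

(** An index below [n] is supported in [finsupp n] and bounded by the maximum of [n], which leaves
    finitely many even for infinite rank. *)
Lemma Nle_finite n : finite_set [set p | Nle p n]%classic.
Proof.
pose F := finsupp n; pose N := \max_(i <- F) n i.
pose g (h : {ffun F -> 'I_N.+1}) : Nsum k :=
  [fsfun i in F => (if insub i is Some u then nat_of_ord (h u) else 0%N) | 0%N].
suff : ([set p | Nle p n] `<=` range g)%classic.
  by move=> /sub_finite_set; apply; apply: finite_image; apply: finite_finset.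
move=> p /= hp; exists [ffun i : F => inord (p (val i))] => //.
apply: Nsum_ext => i; rewrite /g fsfunE.
have [hi|] := boolP (i \in F).
  rewrite insubT ffunE inordK // ltnS; apply: (leq_trans (hp _)).
  by rewrite /N (big_rem i) //= leq_maxl.
by rewrite memNfinsupp => /eqP h; have := hp i; rewrite h leqn0 => /eqP ->.
Qed.

(** The total degree. Sorting by it puts each index before all strictly larger ones. *)
Definition Nweight n : nat := \sum_(i <- finsupp n) n i.

Lemma Nweight_sum n (s : {fset rank_index k}) : (finsupp n `<=` s)%fset ->
  Nweight n = \sum_(i <- s) n i.
Proof.
move=> h; rewrite /Nweight (big_fset_incl _ h) // => i _.
by rewrite memNfinsupp => /eqP.
Qed.

Lemma Nle_weight_eq m n : Nle m n -> (Nweight n <= Nweight m)%N -> m = n.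
Proof.
move=> h; rewrite (@Nweight_sum m (finsupp n)); last first.
  apply/fsubsetP => i; rewrite !mem_finsupp -!lt0n => h0.
  exact: leq_trans h0 (h i).
rewrite /Nweight => hs; apply: Nsum_ext => i.
have [hi|] := boolP (i \in finsupp n); last first.
  by rewrite memNfinsupp => /eqP h0; have := h i; rewrite h0 leqn0 => /eqP.
have h3 : (\sum_(j <- rem i (finsupp n)) m j <= \sum_(j <- rem i (finsupp n)) n j)%N.
  by apply: leq_sum.
rewrite !(big_rem i hi) /= in hs; apply/eqP; rewrite eqn_leq h /= leqNgt; apply/negP => h5.
by have := leq_add h5 h3; rewrite addSn ltnNge hs.
Qed.

End Nsum.

(** * Closed linear sets *)

Section LinearSets.
Context (R : realType) (V : lmodType R[i]).
Implicit Types (M P : set V).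

Definition linear_set M : Prop :=
  M 0 /\ forall (c : R[i]) x y, M x -> M y -> M (c *: x + y).

Lemma linear_setD M x y : linear_set M -> M x -> M y -> M (x + y).
Proof. by move=> [_ h] Mx My; rewrite -[x]scale1r; apply: h. Qed.

Lemma linear_setZ M (c : R[i]) x : linear_set M -> M x -> M (c *: x).
Proof. by move=> [h0 h] Mx; rewrite -[_ *: _]addr0; apply: h. Qed.

Lemma linear_set_sum M (I : eqType) (s : seq I) (F : I -> V) : linear_set M ->
  (forall i, i \in s -> M (F i)) -> M (\sum_(i <- s) F i).
Proof.
move=> hM hF; rewrite big_seq; elim/big_ind: _ => //; first by case: hM.
by move=> x y; apply: linear_setD.
Qed.

Lemma linear_span_linear (G : set V) : linear_set (linear_span G).
Proof.
split; first by exists 0%N, (fun=> 0), (fun=> 0); split=> [[]|] //; rewrite big_ord0.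
move=> c _ _ [l [a [v [hv ->]]]] [l' [a' [v' [hv' ->]]]].
exists (l + l')%N, (fun i => match fintype.split i with inl j => c * a j | inr j => a' j end),
  (fun i => match fintype.split i with inl j => v j | inr j => v' j end).
split; first by move=> i; case: fintype.split.
rewrite big_split_ord /= scaler_sumr; congr (_ + _); apply: eq_bigr => i _.
  by rewrite -[lshift _ _]/(unsplit (inl i)) unsplitK scalerA.
by rewrite -[rshift _ _]/(unsplit (inr i)) unsplitK.
Qed.

Lemma linear_span_sub (G : set V) x : G x -> linear_span G x.
Proof.
move=> Gx; exists 1%N, (fun=> 1), (fun=> x); split => //.
by rewrite big_ord1 scale1r.
Qed.

Lemma linear_span_min (G M : set V) : linear_set M -> (forall x, G x -> M x) ->
  forall x, linear_span G x -> M x.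
Proof.
move=> hM hG x [l [a [v [hv ->]]]]; apply: linear_set_sum => // i _.
by apply: linear_setZ => //; apply: hG.
Qed.

End LinearSets.

Section NormClosure.
Context (R : realType) (V : normedModType R[i]).
Implicit Types (M P : set V).

Lemma ncl_linear M : linear_set M -> linear_set (ncl M).
Proof.
move=> hM; split; first by apply: sub_ncl; case: hM.
move=> c x y hx hy e e0.
have q : 0 <= complex.Re `|c| by rewrite -lecR RRe_real ?normr_ge0 // normr_real.
pose C := complex.Re `|c| + 1.
have C0 : 0 < C by rewrite /C; lra.
have eC : 0 < e / 2 / C by rewrite !divr_gt0.
have e2 : 0 < e / 2 by rewrite divr_gt0.
have [x' Mx' hx'] := hx _ eC; have [y' My' hy'] := hy _ e2.
exists (c *: x' + y'); first by case: hM => _; apply.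
rewrite opprD addrACA -scalerBr; apply: (le_trans (nmD _ _)); rewrite nmZc.
have : complex.Re `|c| * nm (x - x') <= C * (e / 2 / C).
  by apply: ler_pM; rewrite ?nm_ge0 // /C; lra.
have -> : C * (e / 2 / C) = e / 2 by field; rewrite gt_eqF.
lra.
Qed.

(** The induction principle for closed spans: a closed linear condition is checked on generators
    only. *)
Lemma ncl_span_min (G M : set V) : linear_set M -> nclosed M ->
  (forall x, G x -> M x) -> forall x, ncl (linear_span G) x -> M x.
Proof.
move=> lM cM hG x hx; apply: cM => e /hx [y hy hxy].
by exists y => //; apply: linear_span_min hy.
Qed.

End NormClosure.

Lemma nclosed_preim (R : realType) (V W : normedModType R[i]) (f : V -> W) (C : R)
    (M : set W) : (forall x y, nm (f x - f y) <= C * nm (x - y)) -> nclosed M ->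
  nclosed (f @^-1` M)%classic.
Proof.
move=> hf cM x hx; apply: cM => e e0.
have C0 : 0 < `|C| + 1 by rewrite ltr_wpDl.
have [y hy hxy] := hx _ (divr_gt0 e0 C0).
exists (f y) => //; apply: (le_trans (hf _ _)).
have : C * nm (x - y) <= (`|C| + 1) * nm (x - y).
  by rewrite ler_wpM2r ?nm_ge0 //; have := ler_norm C; lra.
by move/le_trans; apply; rewrite mulrC -ler_pdivlMr.
Qed.

Lemma linear_preim (R : realType) (V W : normedModType R[i]) (f : V -> W)
    (M : set W) : f 0 = 0 -> (forall (c : R[i]) x y, f (c *: x + y) = c *: f x + f y) ->
  linear_set M -> linear_set (f @^-1` M)%classic.
Proof. by move=> f0 fl [h0 h]; split=> /= [|c x y]; rewrite ?f0 // fl; apply: h. Qed.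

Section MulSets.
Context (R : realType) (A : cstarAlgType R) (M : set A).

Lemma nclosed_mull a : nclosed M -> nclosed [set b | M (a ** b)]%classic.
Proof. by apply: (@nclosed_preim _ _ _ _ (nm a)) => x y; rewrite -cmulBr nmM. Qed.

Lemma nclosed_mulr a : nclosed M -> nclosed [set b | M (b ** a)]%classic.
Proof.
by apply: (@nclosed_preim _ _ _ _ (nm a)) => x y; rewrite -cmulBl mulrC nmM.
Qed.

Lemma nclosed_star : nclosed M -> nclosed [set b | M (cstar b)]%classic.
Proof.
by apply: (@nclosed_preim _ _ _ _ 1) => x y; rewrite -cstarB mul1r nm_star.
Qed.

Lemma linear_mull a : linear_set M -> linear_set [set b | M (a ** b)]%classic.
Proof.
by apply: linear_preim => [|c x y]; rewrite ?cmul0r // cmulDr cmulZr.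
Qed.

Lemma linear_mulr a : linear_set M -> linear_set [set b | M (b ** a)]%classic.
Proof.
by apply: linear_preim => [|c x y]; rewrite ?cmul0l // cmulDl cmulZl.
Qed.

Lemma linear_star : linear_set M -> linear_set [set b | M (cstar b)]%classic.
Proof.
by move=> [h0 h]; split=> /= [|c x y]; rewrite ?cstar0 // cstarD cstarZ; apply: h.
Qed.

End MulSets.

Lemma nclosed0 (R : realType) (V : normedModType R[i]) : nclosed [set (0 : V)]%classic.
Proof. by move=> x hx; apply: nm_lin0 => e /hx [y ->]; rewrite subr0. Qed.

Lemma linear_set0 (R : realType) (V : normedModType R[i]) : linear_set [set (0 : V)]%classic.
Proof. by split=> // c x y -> ->; rewrite scaler0 addr0. Qed.

(** * Representations of product systems *)

Section Rep.
Context (R : realType) (k : option nat) (A : cstarAlgType R).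
Context (X : product_system A k) (B : cstarAlgType R).
Context (psi : forall n : Nsum k, X n -> B).
Context (hpsi : is_representation psi) (hinj : rep_injective psi).
Implicit Types (p q r d : Nsum k).

Let pi (a : A) : B := psi (psunit X a).

Lemma repP n (c : R[i]) (x y : X n) : psi (c *: x + y) = c *: psi x + psi y.
Proof. by case: hpsi. Qed.

Lemma rep_inner n (x y : X n) : cstar (psi x) ** psi y = pi (inner x y).
Proof. by case: hpsi. Qed.

Lemma repM m n q (e : Nadd m n = q) (x : X m) (y : X n) :
  psi x ** psi y = psi (psmul X e x y).
Proof. by case: hpsi. Qed.

Lemma rep0 n : psi (0 : X n) = 0.
Proof.
have := repP 1 (0 : X n) 0; rewrite !scale1r addr0 => h.
by apply: (@addrI _ (psi (0 : X n))); rewrite addr0 -h.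
Qed.

Lemma repZ n (c : R[i]) (x : X n) : psi (c *: x) = c *: psi x.
Proof. by have := repP c x 0; rewrite rep0 !addr0. Qed.

Lemma repD n (x y : X n) : psi (x + y) = psi x + psi y.
Proof. by have := repP 1 x y; rewrite !scale1r. Qed.

Lemma repB n (x y : X n) : psi (x - y) = psi x - psi y.
Proof. by rewrite -(scaleN1r y) -(scaleN1r (psi y)) repD repZ. Qed.

Lemma rep_star_hom : star_hom_on [set: A]%classic pi.
Proof.
case: hpsi => [[h1 h2 h3] _ _ _]; split; [move=> c a b _ _|move=> a b _ _|move=> a _].
all: by rewrite /pi ?h1 ?h2 ?h3.
Qed.

Lemma rep_unit_inj : injective pi.
Proof. by move=> a b /hinj; apply: (bij_inj (psunit_bij X)). Qed.

Lemma nm_rep_unit a : nm (pi a) = nm a.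
Proof.
apply: (star_hom_isometric (star_subalgT A) (@nclosedT _ A) rep_star_hom) => //.
move=> b _ hb; apply: rep_unit_inj; rewrite hb.
by rewrite (star_hom_on0 (star_subalgT A) rep_star_hom).
Qed.

Lemma nm_rep n (x : X n) : nm (psi x) = nm x.
Proof.
apply/eqP; rewrite -(@eqrXn2 _ 2) ?nm_ge0 // -nm_sstar rep_inner nm_rep_unit.
by apply/eqP; apply: complexI; rewrite rmorphXn /= -!nmE inner_norm.
Qed.

Lemma rep_inj n : injective (@psi n).
Proof.
move=> x y h; apply/eqP; rewrite -subr_eq0; apply/eqP/nm0_eq0.
by rewrite -nm_rep repB h subrr nm0.
Qed.

Lemma rep_ract n (x : X n) a : psi (ract x a) = psi x ** pi a.
Proof. by rewrite (repM (Naddn0 n)) psmul_unitr. Qed.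

Lemma rep_lact n (x : X n) a : psi (lact a x) = pi a ** psi x.
Proof. by rewrite (repM (Nadd0n n)) psmul_unitl. Qed.

Lemma rep_unit_star a : pi (cstar a) = cstar (pi a).
Proof. by rewrite (star_hom_on_star rep_star_hom). Qed.

Lemma rep_unitM a b : pi (cmul a b) = pi a ** pi b.
Proof. by rewrite (star_hom_onM rep_star_hom). Qed.

Definition in_fibre n : set B := range (@psi n).

Lemma in_fibre_linear n : linear_set (in_fibre n).
Proof.
split; first by exists 0; rewrite ?rep0.
by move=> c _ _ [x _ <-] [y _ <-]; exists (c *: x + y); rewrite ?repP.
Qed.

(** [psi] is isometric on the complete space [X n]: approximating fibre elements form a Cauchy
    sequence there. *)
Lemma in_fibre_closed n : nclosed (in_fibre n).
Proof.
move=> b hb.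
have r0 j : 0 < 2^-1 ^+ j :> R by rewrite exprn_gt0.
have step j : exists x : X n, nm (b - psi x) <= 2^-1 ^+ j.
  by have [_ [x _ <-] hx] := hb _ (r0 j); exists x.
have [x hx] := choice step.
have hd j : nm (x j.+1 - x j) <= 2 * 2^-1 ^+ j.
  rewrite -nm_rep repB; apply: (le_trans (nm_tri b _ _)); rewrite nmBC.
  by have := hx j; have := hx j.+1; rewrite exprS; have := r0 j; lra.
have half : 0 <= (2^-1 : R) < 1 by apply/andP; split; lra.
have [l hl] := nm_rapid_cauchy half hd.
exists l => //; apply/esym/eqP; rewrite -subr_eq0; apply/eqP/nm_lin0 => e e0.
have e2 : 0 < e / 2 by rewrite divr_gt0.
have [N hN] := geometric_small (2 / (1 - 2^-1)) half e2.
have [N' hN'] := geometric_small 1 half e2.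
pose m := maxn N N'.
apply: (le_trans (nm_tri (psi (x m)) _ _)); rewrite -repB nm_rep.
have := hl m; have := hx m; have := hN _ (leq_maxl N N').
have := hN' _ (leq_maxr N N'); rewrite -/m; lra.
Qed.

(** Density of the elementary tensors, transported to [B] as an induction principle. *)
Lemma rep_mul_dense p d r (e : Nadd p d = r) (P : set B) :
  p <> Nzero -> d <> Nzero -> nclosed P -> linear_set P ->
  (forall (x : X p) (y : X d), P (psi x ** psi y)) -> forall z : X r, P (psi z).
Proof.
move=> p0 d0 cP lP hP z.
have hz : ncl (linear_span [set t : X r | exists x y, t = psmul X e x y]%classic) z.
  by rewrite nclE (tensor_dense (@psmul_tensor _ _ _ X _ _ _ e p0 d0)).
apply: (ncl_span_min (M := (@psi r @^-1` P)%classic)) hz.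
- by apply: linear_preim => //; [exact: rep0|exact: repP].
- by apply: (@nclosed_preim _ _ _ _ 1) => // x y; rewrite -repB nm_rep mul1r.
- by move=> _ [x [y ->]] /=; rewrite -repM.
Qed.

(** On a product z = x' y the left factors combine to the inner product of [x] and x', which acts on
    [y]. Degrees zero are treated apart because only nonzero degrees have the tensor isomorphism. *)
Lemma rep_star_mul p d r (e : Nadd p d = r) (x : X p) (z : X r) :
  in_fibre d (cstar (psi x) ** psi z).
Proof.
have [p0|p0] := eqVneq p Nzero.
  subst p; have [a ax] : exists a, psunit X a = x.
    by have [g _ gK] := psunit_bij X; exists (g x).
  have dr : d = r by rewrite -e Nadd0n.
  subst d; exists (lact (cstar a) z) => //.
  by rewrite rep_lact rep_unit_star -ax.
have [d0|d0] := eqVneq d Nzero.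
  subst d; have pr : p = r by rewrite -e Naddn0.
  by subst p; rewrite rep_inner; exists (psunit X (inner x z)).
move: z; apply: (rep_mul_dense e (P := [set b | in_fibre d (cstar (psi x) ** b)]%classic)).
- exact/eqP.
- exact/eqP.
- by apply: nclosed_mull; apply: in_fibre_closed.
- by apply: linear_mull; apply: in_fibre_linear.
- move=> x' y /=; rewrite cmulA rep_inner -rep_lact.
  by exists (lact (inner x x') y).
Qed.

(** * Images of the compact operators in [B] *)

Definition finite_rank_image p : set B :=
  linear_span [set b | exists x y : X p, b = psi x ** cstar (psi y)]%classic.

(** This is K_p, the image of the compact operators under psi^(p), as [psiK_cpt] and [psiK_mul_op]
    show. *)
Definition cpt_image p : set B := ncl (finite_rank_image p).

Lemma cpt_image_linear p : linear_set (cpt_image p).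
Proof. by apply: ncl_linear; apply: linear_span_linear. Qed.

Lemma cpt_image_theta p (x y : X p) : cpt_image p (psi x ** cstar (psi y)).
Proof. by apply: sub_ncl; apply: linear_span_sub; exists x, y. Qed.

Lemma cpt_image_min p (M : set B) : linear_set M -> nclosed M ->
  (forall x y : X p, M (psi x ** cstar (psi y))) -> forall b, cpt_image p b -> M b.
Proof. by move=> lM cM h b; apply: ncl_span_min => // _ [x [y ->]]. Qed.

Lemma cpt_image_closed p : nclosed (cpt_image p).
Proof. exact: ncl_ncl. Qed.

(** The adjoint of [psi y] takes the fibre over [r] to the one over r - p, and [psi x] takes it
    back. *)
Lemma cpt_image_fibre p r b (z : X r) : Nle p r -> cpt_image p b ->
  in_fibre r (b ** psi z).
Proof.
move=> pr; apply: (cpt_image_min (M := [set b | in_fibre r (b ** psi z)]%classic)).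
- by apply: linear_mulr; apply: in_fibre_linear.
- by apply: nclosed_mulr; apply: in_fibre_closed.
move=> x y /=; rewrite -cmulA.
have e := Naddn_sub pr; have [w _ <-] := rep_star_mul e y z.
by rewrite (repM e); exists (psmul X e x w).
Qed.

Lemma cpt_image_star p b : cpt_image p b -> cpt_image p (cstar b).
Proof.
apply: (cpt_image_min (M := [set b | cpt_image p (cstar b)]%classic)).
- by apply: linear_star; apply: cpt_image_linear.
- by apply: nclosed_star; apply: cpt_image_closed.
- by move=> x y /=; rewrite cstarM cstarK; apply: cpt_image_theta.
Qed.

Lemma cpt_imageM p b b' : cpt_image p b -> cpt_image p b' -> cpt_image p (b ** b').
Proof.
move=> hb; apply: (cpt_image_min (M := [set b' | cpt_image p (b ** b')]%classic)).
- by apply: linear_mull; apply: cpt_image_linear.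
- by apply: nclosed_mull; apply: cpt_image_closed.
move=> x y /=; rewrite cmulA.
have [z _ <-] := cpt_image_fibre x (Nle_refl p) hb; exact: cpt_image_theta.
Qed.

Lemma cpt_image_subalg p : star_subalg (cpt_image p).
Proof.
have [h0 h] := cpt_image_linear p; split => //.
- exact: cpt_imageM.
- exact: cpt_image_star.
Qed.

(** The adjoint of [b] is in the closed span of products that [b] kills from the left, so b b^* = 0.
    Thus K_p acts faithfully on its fibre. *)
Lemma cpt_image_eq0 p b : cpt_image p b -> (forall z : X p, b ** psi z = 0) -> b = 0.
Proof.
move=> hb hz; apply: starr_eq0.
have : cpt_image p (cstar b) by apply: cpt_image_star.
apply: (cpt_image_min (M := [set c | b ** c = 0]%classic)).
- exact: (linear_mull b (linear_set0 B)).
- exact: (nclosed_mull (@nclosed0 _ B)).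
- by move=> x y /=; rewrite cmulA hz cmul0l.
Qed.

(** Without a unit, [iter a (cmul m) m] stands for m^(a+1), whence the shifts by one. *)
Let pow_cmul (m : B) a b :
  iter a (cmul m) m ** iter b (cmul m) m = iter (a + b).+1 (cmul m) m.
Proof. by elim: a => [|a IH] //=; rewrite -cmulA IH. Qed.

Let square_iter_pow (m : B) j : square_iter j m = iter (2 ^ j).-1 (cmul m) m.
Proof.
elim: j => //= j ->; rewrite pow_cmul; congr (iter _ (cmul m) m).
have : (0 < 2 ^ j)%N by rewrite expn_gt0.
by rewrite expnS mul2n -addnn; case: (2 ^ j)%N => // n _; rewrite addSn addnS.
Qed.

(* With [m = b b^*], the norm of [m^N = m^(N-1) (b b^* )] is at most [C eps^(2 N)], where [C]
   only depends on an expansion of [b] as a finite sum. *)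
Lemma nm_finite_rank p (b : B) (eps : R) : 0 < eps ->
  finite_rank_image p b ->
  (forall z : X p, nm (b ** psi z) <= eps * nm z) -> nm b <= eps.
Proof.
move=> e0 hb hz; pose m := b ** cstar b.
have sm : cstar m = m by rewrite cstarM cstarK.
have cb : cpt_image p b by apply: sub_ncl.
(* The adjoint obeys the same bound on the fibre, by Cauchy-Schwarz applied to z and b b^* z. *)
have hz' (z : X p) : nm (cstar b ** psi z) <= eps * nm z.
  have [w _ hw] := cpt_image_fibre z (Nle_refl p) (cpt_image_star cb).
  have h : nm (cstar b ** psi z) ^+ 2 <= nm z * (eps * nm (cstar b ** psi z)).
    rewrite -nm_sstar cstarM cstarK -cmulA -hw.
    apply: (le_trans (nmM _ _)); rewrite nm_star !nm_rep.
    by rewrite ler_wpM2l ?nm_ge0 // hz.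
  have [h0|h0] := leP (nm (cstar b ** psi z)) 0.
    by apply: (le_trans h0); rewrite mulr_ge0 ?nm_ge0 // ltW.
  by rewrite -(ler_pM2r h0) -expr2; apply: (le_trans h); rewrite mulrA (mulrC (nm z)).
have hm n (z : X p) : exists2 w : X p, iter n (cmul m) (psi z) = psi w &
    nm w <= (eps ^+ 2) ^+ n * nm z.
  elim: n => [|n [w hw nw]]; first by exists z; rewrite ?mul1r.
  have [v _ hv] := cpt_image_fibre w (Nle_refl p) (cpt_image_star cb).
  have [u _ hu] := cpt_image_fibre v (Nle_refl p) cb.
  exists u; first by rewrite iterS hw -cmulA -hv.
  rewrite -nm_rep hu; apply: (le_trans (hz _)); rewrite -nm_rep hv.
  rewrite exprS expr2 -!mulrA ler_pM2l //; apply: (le_trans (hz' _)).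
  by rewrite ler_pM2l.
(* The existence of [C] is a linear condition on [b], so it suffices to treat psi x psi(y)^* , where
   m^n acts on [psi x] inside the fibre. *)
have [C hC] : exists C, forall n, nm (iter n (cmul m) b) <= C * (eps ^+ 2) ^+ n.
  have il n : iter n (cmul m) 0 = 0 by elim: n => //= n ->; rewrite cmul0r.
  have ilin n c x y : iter n (cmul m) (c *: x + y) =
      c *: iter n (cmul m) x + iter n (cmul m) y.
    by elim: n => //= n ->; rewrite cmulDr cmulZr.
  have imul n x y : iter n (cmul m) (x ** y) = iter n (cmul m) x ** y.
    by elim: n => //= n ->; rewrite cmulA.
  apply: (linear_span_min (M := [set b | exists C, forall n,
    nm (iter n (cmul m) b) <= C * (eps ^+ 2) ^+ n]%classic)) hb.
    split => [|c x y [C1 h1] [C2 h2]]; first by exists 0 => n; rewrite il nm0 mul0r.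
    exists (complex.Re `|c| * C1 + C2) => n; rewrite ilin.
    apply: (le_trans (nmD _ _)); rewrite nmZc mulrDl lerD // -mulrA ler_wpM2l //.
    by rewrite -lecR RRe_real ?normr_ge0 // normr_real.
  move=> _ [x [y ->]]; exists (nm x * nm y) => n; rewrite imul.
  have [w -> hw] := hm n x; apply: (le_trans (nmM _ _)).
  rewrite nm_star !nm_rep mulrAC ler_wpM2r ?nm_ge0 // mulrC //.
have imul n x y : iter n (cmul m) (x ** y) = iter n (cmul m) x ** y.
  by elim: n => //= n ->; rewrite cmulA.
suff : nm m <= eps ^+ 2.
  by rewrite nm_starr ler_pXn2r // ?nnegrE ?nm_ge0 // ltW.
(* One factor [m] is spent as b b^* ; the quotient by [eps ^+ 2] makes up for the missing power. *)
apply: (@expr2n_dominated _ _ _ (C * nm b / eps ^+ 2)); rewrite ?nm_ge0 ?sqr_ge0 //.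
move=> j; rewrite -nm_square_iter // square_iter_pow {2}/m imul.
apply: (le_trans (nmM _ _)); rewrite nm_star.
have j0 : (0 < 2 ^ j)%N by rewrite expn_gt0.
rewrite -{2}(prednK j0) (exprS (eps ^+ 2)).
have -> : C * nm b / eps ^+ 2 * (eps ^+ 2 * (eps ^+ 2) ^+ (2 ^ j).-1) =
  C * (eps ^+ 2) ^+ (2 ^ j).-1 * nm b by field; rewrite gt_eqF.
by rewrite ler_wpM2r ?nm_ge0.
Qed.

Let finite_rank_rep p (T : X p -> X p) :
  linear_span [set U | exists x y : X p, U = theta x y]%classic T ->
  exists2 b, finite_rank_image p b &
    forall z, b ** psi z = psi (T z).
Proof.
pose G := finite_rank_image p.
have [G0 Glin] : linear_set G by apply: linear_span_linear.
apply: (linear_span_min (M := [set T | exists2 b, G b & forall z, b ** psi z = psi (T z)]%classic)).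
  split; first by exists 0 => // z; rewrite cmul0l rep0.
  move=> c U V [b hb hU] [b' hb' hV]; exists (c *: b + b'); first exact: Glin.
  by move=> z; rewrite cmulDl cmulZl hU hV -repP.
move=> _ [x [y ->]]; exists (psi x ** cstar (psi y)).
  by apply: linear_span_sub; exists x, y.
by move=> z; rewrite -cmulA rep_inner -rep_ract.
Qed.

Let finite_rank_op p b :
  finite_rank_image p b ->
  exists2 T, linear_span [set U | exists x y : X p, U = theta x y]%classic T
    & forall z, b ** psi z = psi (T z).
Proof.
pose G : set (X p -> X p) := linear_span [set U | exists x y : X p, U = theta x y]%classic.
have [G0 Glin] : linear_set G by apply: linear_span_linear.
apply: (linear_span_min (M := [set b | exists2 T, G T & forall z, b ** psi z = psi (T z)]%classic)).
  split; first by exists 0 => // z; rewrite cmul0l rep0.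
  move=> c U V [b1 hb hU] [b' hb' hV]; exists (c *: b1 + b'); first exact: Glin.
  by move=> z; rewrite cmulDl cmulZl hU hV -repP.
move=> _ [x [y ->]]; exists (theta x y).
  by apply: linear_span_sub; exists x, y.
by move=> z; rewrite -cmulA rep_inner -rep_ract.
Qed.

Lemma opdist_leE p (S T : X p -> X p) (e : R) :
  opdist_le S T (e%:C)%C <-> forall z, nm (S z - T z) <= e * nm z.
Proof.
by split=> h z; have := h z; rewrite !nmE -rmorphM /= lecR.
Qed.

(** [nm_finite_rank] turns closeness of finite-rank operators on X_p into closeness of their
    representatives in [B], so the representatives of approximants of [S] converge. *)
Lemma compact_op_rep p (S : X p -> X p) : compact_op S ->
  exists2 b, cpt_image p b & forall z, b ** psi z = psi (S z).
Proof.
move=> [_ hS].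
have r0 j : 0 < 2^-1 ^+ j :> R by rewrite exprn_gt0.
have step j : exists Tb : (X p -> X p) * B, [/\ forall z, nm (S z - Tb.1 z) <= 2^-1 ^+ j * nm z,
    finite_rank_image p Tb.2 &
    forall z, Tb.2 ** psi z = psi (Tb.1 z)].
  have rj : 0 < ((2^-1 ^+ j : R)%:C)%C by rewrite ltcR.
  have [T hT /opdist_leE hd] := hS _ rj.
  by have [b hb hbT] := finite_rank_rep hT; exists (T, b).
have [Tb hTb] := choice step.
pose b j := (Tb j).2; pose T j := (Tb j).1.
have hd j : nm (b j.+1 - b j) <= 2 * 2^-1 ^+ j.
  have [h1 h2 h3] := hTb j; have [h1' h2' h3'] := hTb j.+1.
  apply: (@nm_finite_rank p); first by rewrite mulr_gt0.
    have [_ Glin] := linear_span_linear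
      [set b | exists x y : X p, b = psi x ** cstar (psi y)]%classic.
    by rewrite addrC -scaleN1r; apply: Glin.
  move=> z; rewrite cmulBl h3 h3' -repB nm_rep.
  apply: (le_trans (nm_tri (S z) _ _)); rewrite nmBC.
  have := h1 z; have := h1' z; have := mulr_ge0 (ltW (r0 j)) (nm_ge0 z); rewrite exprS; lra.
have half : 0 <= (2^-1 : R) < 1 by apply/andP; split; lra.
have [l hl] := nm_rapid_cauchy half hd.
have hsmall e : 0 < e -> exists j, nm (b j - l) <= e /\ 2^-1 ^+ j <= e.
  move=> e0; have [N hN] := geometric_small (2 / (1 - 2^-1)) half e0.
  have [N' hN'] := geometric_small 1 half e0.
  exists (maxn N N'); split; first by apply: (le_trans (hl _)); apply/hN/leq_maxl.
  by have := hN' _ (leq_maxr N N'); rewrite mul1r.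
exists l.
  apply: cpt_image_closed => e /hsmall [j [hj _]]; exists (b j); last by rewrite nmBC.
  by apply: sub_ncl; have [] := hTb j.
move=> z; apply/eqP; rewrite -subr_eq0; apply/eqP/nm_lin0 => e e0.
have C0 : 0 < 2 * (nm z + 1) by have := nm_ge0 z; lra.
have [j [hj1 hj2]] := hsmall _ (divr_gt0 e0 C0).
have [h1 h2 h3] := hTb j.
apply: (le_trans (nm_tri (b j ** psi z) _ _)); rewrite -cmulBl h3 -repB nm_rep (nmBC (_ z)).
have := h1 z; have := nmM (l - b j) (psi z); rewrite nm_rep (nmBC l).
have z0 := nm_ge0 z.
have := ler_wpM2r z0 hj1; have := ler_wpM2r z0 hj2.
have : e / (2 * (nm z + 1)) * nm z <= e / 2.
  by rewrite mulrAC ler_pdivrMr //; nra.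
lra.
Qed.

(** [psiK] is a choice among admissible values. Here [b] is admissible, and any other one lies in
    K_p and acts equally on the fibre, so [cpt_image_eq0] identifies them. *)
Lemma psiK_eq p (S : X p -> X p) b : cpt_image p b ->
  (forall z, b ** psi z = psi (S z)) -> psiK psi S = b.
Proof.
move=> hb hS; apply: xget_unique.
  move=> e e0; have er : e = (complex.Re e)%:C%C by rewrite RRe_real // gtr0_real.
  have e0' : 0 < complex.Re e by rewrite -ltcR -er.
  have [c [l [a [v [hv ->]]]] hbc] := hb _ e0'.
  have hv' i : exists xy : X p * X p, v i = psi xy.1 ** cstar (psi xy.2).
    by have [x [y h]] := hv i; exists (x, y).
  have [xy hxy] := choice hv'.
  have hc : \sum_(i < l) a i *: v i =
      \sum_(i < l) cmul (psi (a i *: (xy i).1)) (cstar (psi (xy i).2)).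
    by apply: eq_bigr => i _; rewrite hxy repZ cmulZl.
  exists l, (fun i => a i *: (xy i).1), (fun i => (xy i).2); split; last first.
    by rewrite -hc er -nm_le.
  rewrite er; apply/opdist_leE => z.
  rewrite -nm_rep repB -hS.
  have -> : psi ((\sum_(i < l) theta (a i *: (xy i).1) (xy i).2) z) =
      (\sum_(i < l) a i *: v i) ** psi z.
    rewrite hc fct_sumE cmul_suml (big_morph (@psi p) (@repD p) (rep0 p)).
    by apply: eq_bigr => i _; rewrite -cmulA rep_inner -rep_ract.
  rewrite -cmulBl; apply: (le_trans (nmM _ _)); rewrite nm_rep.
  by rewrite ler_wpM2r ?nm_ge0.
move=> b' hb'.
have approx e : 0 < e -> exists c, [/\ cpt_image p c, nm (b' - c) <= e &
    forall z, nm (psi (S z) - c ** psi z) <= e * nm z].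
  move=> e0; have e0' : 0 < e%:C%C by rewrite ltcR.
  have [l [x [y [/opdist_leE h1 h2]]]] := hb' _ e0'.
  exists (\sum_(i < l) cmul (psi (x i)) (cstar (psi (y i)))); split.
  - by apply: linear_set_sum => [|i _]; [exact: cpt_image_linear|exact: cpt_image_theta].
  - by rewrite nm_le.
  move=> z; apply: le_trans (h1 z); rewrite -nm_rep repB fct_sumE.
  rewrite (big_morph (@psi p) (@repD p) (rep0 p)) cmul_suml.
  rewrite le_eqVlt; apply/orP; left; apply/eqP; congr (nm (_ - _)).
  by apply: eq_bigr => i _; rewrite -cmulA rep_inner -rep_ract.
have cb' : cpt_image p b'.
  by apply: cpt_image_closed => e /approx [c [h1 h2 _]]; exists c.
apply/eqP; rewrite -subr_eq0; apply/eqP; apply: (@cpt_image_eq0 p).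
  have [_ h] := cpt_image_linear p.
  by rewrite addrC -scaleN1r; apply: h.
move=> z; rewrite cmulBl hS; apply: nm_lin0 => e e0.
have C0 : 0 < 2 * (nm z + 1) by have := nm_ge0 z; lra.
have [c [h1 h2 h3]] := approx _ (divr_gt0 e0 C0).
apply: (le_trans (nm_tri (c ** psi z) _ _)); rewrite -cmulBl (nmBC (c ** _)).
have := h3 z; have := nmM (b' - c) (psi z); rewrite nm_rep.
have z0 := nm_ge0 z; have := ler_wpM2r z0 h2.
have : e / (2 * (nm z + 1)) * nm z <= e / 2.
  by rewrite mulrAC ler_pdivrMr //; nra.
lra.
Qed.

Lemma psiK_cpt p (S : X p -> X p) : compact_op S -> cpt_image p (psiK psi S).
Proof. by move=> /compact_op_rep [b hb hS]; rewrite (psiK_eq hb hS). Qed.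

Lemma psiK_rep p (S : X p -> X p) : compact_op S ->
  forall z, psiK psi S ** psi z = psi (S z).
Proof. by move=> /compact_op_rep [b hb hS]; rewrite (psiK_eq hb hS). Qed.

(** Multiplication by [b] read back on X_r, with default 0 where the product leaves the fibre; hence
    the [in_fibre] hypotheses below. *)
Definition mul_op r (b : B) (z : X r) : X r := xget 0 [set y | psi y = b ** psi z]%classic.

Lemma mul_opE r b (z : X r) : in_fibre r (b ** psi z) -> psi (mul_op b z) = b ** psi z.
Proof. by move=> [y _ hy]; apply: (@xgetPex _ 0 [set y | psi y = _]%classic); exists y. Qed.

Lemma mul_op_adjointable r b : (forall z : X r, in_fibre r (b ** psi z)) ->
  (forall z : X r, in_fibre r (cstar b ** psi z)) -> adjointable (mul_op b : X r -> X r).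
Proof.
move=> h h'; exists (mul_op (cstar b)) => x y; apply: rep_unit_inj.
by rewrite -!rep_inner !mul_opE // cstarM cmulA.
Qed.

Lemma mul_op_compact p b : cpt_image p b -> compact_op (mul_op b : X p -> X p).
Proof.
move=> hb; have hE z := cpt_image_fibre z (Nle_refl p) hb.
split.
  apply: mul_op_adjointable => // z.
  by apply: cpt_image_fibre (Nle_refl p) _; apply: cpt_image_star.
move=> e e0; have er : e = (complex.Re e)%:C%C by rewrite RRe_real // gtr0_real.
have e0' : 0 < complex.Re e by rewrite -ltcR -er.
have [c hc hbc] := hb _ e0'; have [T hT hcT] := finite_rank_op hc.
exists T => //; rewrite er; apply/opdist_leE => z.
rewrite -nm_rep repB mul_opE // -hcT -cmulBl; apply: (le_trans (nmM _ _)).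
by rewrite nm_rep ler_wpM2r ?nm_ge0.
Qed.

Lemma psiK_mul_op p b : cpt_image p b -> psiK psi (mul_op b : X p -> X p) = b.
Proof.
by move=> hb; apply: psiK_eq => // z; rewrite mul_opE //; apply: cpt_image_fibre (Nle_refl p) hb.
Qed.

Lemma cpt_image0 b : cpt_image Nzero b -> exists a, b = pi a.
Proof.
move=> hb; suff [x _ <-] : in_fibre Nzero b.
  by have [g _ gK] := psunit_bij X; exists (g x); rewrite /pi gK.
move: b hb; apply: cpt_image_min.
- exact: in_fibre_linear.
- exact: in_fibre_closed.
move=> x y; have [g _ gK] := psunit_bij X.
exists (psunit X (g x ** cstar (g y))) => //.
by rewrite -/(pi _) rep_unitM rep_unit_star /pi !gK.
Qed.

Lemma lact_psiK a : compact_op (lact a : X Nzero -> X Nzero) ->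
  psiK psi (lact a : X Nzero -> X Nzero) = pi a.
Proof.
move=> hS; have [a' ha'] := cpt_image0 (psiK_cpt hS).
rewrite ha'; apply/eqP; rewrite -subr_eq0; apply/eqP/starr_eq0.
rewrite -(star_hom_onB (star_subalgT A) rep_star_hom) // -rep_unit_star.
rewrite (star_hom_onB (star_subalgT A) rep_star_hom) // cmulBl -ha'.
by rewrite {1}/pi psiK_rep // rep_lact subrr.
Qed.

(** The uniqueness behind [iota_op]: every operator in the graph is multiplication by psi^(p)(S). *)
Lemma iota_graph_rep p r (S : X p -> X p) (T : X r -> X r) : Nle p r ->
  iota_graph S T -> compact_op S -> forall z : X r, psi (T z) = psiK psi S ** psi z.
Proof.
move=> pr h; case: h pr => {p r S T}.
- by move=> p S _ hS z; rewrite psiK_rep.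
- by move=> q a _ hS z; rewrite lact_psiK // rep_lact.
move=> p d q e S T p0 d0 [T' hT'] hT pq hS z.
set b := psiK psi S.
have hb : cpt_image p b by apply: psiK_cpt.
have hT'' v w : inner v (T w) = inner (T' v) w.
  by rewrite -inner_star hT' inner_star.
(* Moving [T] to the other side as [T'] gives a closed linear condition on [psi z], so elementary
   tensors suffice. *)
have key (v : X q) : cstar (psi v) ** (psi (T z) - b ** psi z) = 0.
  rewrite cmulBr rep_inner hT'' -rep_inner cmulA -cmulBl.
  apply: (rep_mul_dense e (P := [set c |
    (cstar (psi (T' v)) - cstar (psi v) ** b) ** c = 0]%classic)) => //.
  - exact: (nclosed_mull (@nclosed0 _ B)).
  - exact: (linear_mull _ (linear_set0 B)).
  move=> x y /=; rewrite cmulBl (repM e) rep_inner -hT'' -rep_inner hT -!(repM e).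
  by rewrite -!cmulA (cmulA b) psiK_rep // subrr.
have [u _ hu] := cpt_image_fibre z pq hb.
apply/eqP; rewrite -subr_eq0; apply/eqP/sstar_eq0.
by rewrite -{1}hu -repB key.
Qed.

(** The existence behind [iota_op], so that its choice does not return the default. *)
Lemma iota_graph_mul_op p r (S : X p -> X p) : Nle p r -> compact_op S ->
  exists T : X r -> X r, iota_graph S T.
Proof.
move=> pr hS; set b := psiK psi S.
have hb : cpt_image p b by apply: psiK_cpt.
have [rp|rp] := eqVneq p r; first by subst r; exists S; constructor.
have [p0|p0] := eqVneq p Nzero.
  subst p; have [a ha] := cpt_image0 hb; exists (lact a).
  have -> : S = lact a; last by constructor.
  apply/funext => z; apply: rep_inj.
  by rewrite rep_lact -psiK_rep // -/b ha.
exists (mul_op b).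
apply: (@iota_tensor _ _ _ _ p (Nsub r p) r (Naddn_sub pr)).
- exact/eqP.
- by apply: Nsub_neq0 => //; apply/eqP.
- apply: mul_op_adjointable => z; apply: cpt_image_fibre pr _ => //.
  exact: cpt_image_star.
- move=> x y; apply: rep_inj; rewrite mul_opE; last exact: cpt_image_fibre pr _.
  by rewrite -!(repM (Naddn_sub pr)) cmulA psiK_rep.
Qed.

Lemma iota_opE p r (S : X p -> X p) : Nle p r -> compact_op S ->
  forall z : X r, psi (iota_op S z) = psiK psi S ** psi z.
Proof.
move=> pr hS; apply: iota_graph_rep => //.
have [T hT] := iota_graph_mul_op pr hS.
by apply: (@xgetPex _ _ [set T | iota_graph S T]%classic); exists T.
Qed.

(** The inner product of [z] with itself acts on X_m as psi(z)^* psi(z), which kills [psi y] exactly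
    when [psi z] does. Membership in X_r I_(q-r) thus becomes annihilation in [B]. *)
Lemma XIP q r (z : X r) : XI q z <->
  forall m (y : X m), m <> Nzero -> Nle m (Nsub q r) -> psi z ** psi y = 0.
Proof.
split=> h m.
  move=> y m0 hm; apply: sstar_eq0; rewrite cstarM -cmulA (cmulA (cstar (psi z))) rep_inner.
  by rewrite -rep_lact h // rep0 cmul0r.
by move=> m0 hm y; apply: rep_inj; rewrite rep_lact -rep_inner -cmulA h // cmul0r rep0.
Qed.

Lemma XI_ideal q r (z : X r) b : in_fibre r (b ** psi z) -> XI q z -> XI q (mul_op b z : X r).
Proof.
move=> hb /XIP hz; apply/XIP => m y m0 hm.
by rewrite mul_opE // -cmulA hz // cmul0r.
Qed.

Context (hX : compactly_aligned X) (hN : nica_covariant psi).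

(** Nica covariance puts the product into the image of psi^(p v q), and compact alignment makes its
    argument compact. *)
Lemma cpt_image_join p q b c : cpt_image p b -> cpt_image q c ->
  cpt_image (Njoin p q) (b ** c).
Proof.
move=> hb hc; rewrite -(psiK_mul_op hb) -(psiK_mul_op hc).
have cb := mul_op_compact hb; have cc := mul_op_compact hc.
by rewrite hN //; apply: psiK_cpt; apply: hX.
Qed.

(* [psi z psi(z)^*] annihilates the fibre over [p \/ r], because elements of that fibre start
   with some [psi y], [y] in [X_r], and [p \/ r - r] is nonzero. *)
Lemma XI_vanish p q r b (z : X r) : cpt_image p b -> XI q z ->
  Nle p q -> Nle r q -> ~ Nle p r -> b ** psi z = 0.
Proof.
move=> hb /XIP hz pq rq pr; pose s := Njoin p r.
have rs : Nle r s by apply: Nle_joinr.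
have m0 : Nsub s r <> Nzero.
  by apply: Nsub_neq0 => // h; apply: pr; rewrite h; apply: Nle_joinl.
have hm : Nle (Nsub s r) (Nsub q r) by apply: Nle_sub; apply: Njoin_lub.
have hkill (w : X s) : psi z ** (cstar (psi z) ** psi w) = 0.
  by have [u _ <-] := rep_star_mul (Naddn_sub rs) z w; rewrite hz.
(* This product lies in K_s, where vanishing is tested on the fibre over [s]. It then forces the
   product of b psi z with its adjoint to vanish. *)
have h : b ** (psi z ** cstar (psi z)) = 0.
  apply: (@cpt_image_eq0 s); first exact: cpt_image_join (cpt_image_theta z z).
  by move=> w; rewrite -!cmulA hkill cmul0r.
apply: starr_eq0; rewrite cstarM -!cmulA (cmulA (psi z)) cmulA h cmul0l //.
Qed.

End Rep.

(** * Closed *-subalgebras as C*-algebras *)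

Section ClosedSubalgebra.
Context (R : realType) (L : cstarAlgType R) (M : set L).
Context (hM : star_subalg M) (cM : nclosed M).

(* The proofs are parameters so that the canonical instances can be keyed on this predicate. *)
Definition subalg_pred of star_subalg M & nclosed M : {pred L} := fun x => `[< M x >].

Local Notation P := (subalg_pred hM cM).

Lemma subalg_predP x : reflect (M x) (x \in P).
Proof. exact: asboolP. Qed.

Lemma subalg_submod : submod_closed P.
Proof.
split; first by apply/subalg_predP; apply: star_subalg0.
by move=> c x y /subalg_predP hx /subalg_predP hy; apply/subalg_predP; apply: star_subalg_lin.
Qed.

HB.instance Definition _ := GRing.isSubmodClosed.Build R[i] L P subalg_submod.

Definition subalg_type : Type := {x : L | P x}.

HB.instance Definition _ := [isSub of subalg_type for @sval _ _].
HB.instance Definition _ := [Choice of subalg_type by <:].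
HB.instance Definition _ := [SubChoice_isSubLmodule of subalg_type by <:].

Definition subalg_norm (x : subalg_type) : R[i] := `|val x|.

Lemma subalg_normD x y : subalg_norm (x + y) <= subalg_norm x + subalg_norm y.
Proof. exact: ler_normD. Qed.

Lemma subalg_normZ (l : R[i]) x : subalg_norm (l *: x) = `|l| * subalg_norm x.
Proof. exact: normrZ. Qed.

Lemma subalg_norm0 x : subalg_norm x = 0 -> x = 0.
Proof. by move=> h; apply: val_inj; apply: normr0_eq0. Qed.

HB.instance Definition _ := Lmodule_isNormed.Build R[i] subalg_type
  subalg_normD subalg_normZ subalg_norm0.

Lemma subalg_complete (F : set_system subalg_type) :
  ProperFilter F -> cauchy F -> cvg F.
Proof.
move=> FF /cauchyP hF.
pose G : set_system L := (val @ F)%classic.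
have hG : cauchy G.
  apply: cauchy_exP => e e0; have [x hx] := hF e e0.
  exists (val x); rewrite /G /=; move: hx; rewrite -!ball_normE.
  by apply: filterS => y.
have /cvg_ex [l hl] : cvg G by apply: cauchy_cvg.
have hball e : 0 < e -> F [set y | `|l - val y| < e]%classic.
  by move=> e0; have := hl _ (nbhsx_ballx l e e0); rewrite -ball_normE.
have Ml : M l.
  apply: cM => e e0; have e0' : 0 < e%:C%C by rewrite ltcR.
  have [y hy] := filter_ex (hball _ e0').
  exists (val y); first by apply/subalg_predP; apply: valP.
  by rewrite nm_le ltW.
have Pl : P l by apply/subalg_predP.
apply/cvg_ex; exists (Sub l Pl : subalg_type) => U /nbhs_ballP [e /= e0 hU].
by have := hball e e0; apply: filterS => y hy; apply: hU; rewrite -ball_normE.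
Qed.

HB.instance Definition _ := Uniform_isComplete.Build subalg_type subalg_complete.

Let mulP (x y : subalg_type) : P (val x ** val y).
Proof.
by apply/subalg_predP; apply: star_subalgM => //; apply/subalg_predP; apply: valP.
Qed.

Let starP (x : subalg_type) : P (cstar (val x)).
Proof.
by apply/subalg_predP; apply: star_subalg_star => //; apply/subalg_predP; apply: valP.
Qed.

Definition subalg_mul (x y : subalg_type) : subalg_type := Sub _ (mulP x y).
Definition subalg_star (x : subalg_type) : subalg_type := Sub _ (starP x).

Let mA a b c : subalg_mul a (subalg_mul b c) = subalg_mul (subalg_mul a b) c.
Proof. by apply: val_inj; apply: cmulA. Qed.
Let mDl a b c : subalg_mul (a + b) c = subalg_mul a c + subalg_mul b c.
Proof. by apply: val_inj; apply: cmulDl. Qed.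
Let mDr a b c : subalg_mul a (b + c) = subalg_mul a b + subalg_mul a c.
Proof. by apply: val_inj; apply: cmulDr. Qed.
Let mZl (z : R[i]) a b : subalg_mul (z *: a) b = z *: subalg_mul a b.
Proof. by apply: val_inj; apply: cmulZl. Qed.
Let mZr (z : R[i]) a b : subalg_mul a (z *: b) = z *: subalg_mul a b.
Proof. by apply: val_inj; apply: cmulZr. Qed.
Let sK a : subalg_star (subalg_star a) = a.
Proof. by apply: val_inj; apply: cstarK. Qed.
Let sD a b : subalg_star (a + b) = subalg_star a + subalg_star b.
Proof. by apply: val_inj; apply: cstarD. Qed.
Let sZ (z : R[i]) a : subalg_star (z *: a) = Num.conj z *: subalg_star a.
Proof. by apply: val_inj; apply: cstarZ. Qed.
Let sM a b : subalg_star (subalg_mul a b) = subalg_mul (subalg_star b) (subalg_star a).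
Proof. by apply: val_inj; apply: cstarM. Qed.
Let nM a b : `|subalg_mul a b| <= `|a| * `|b|.
Proof. exact: cnormM. Qed.
Let nS a : `|subalg_mul (subalg_star a) a| = `|a| ^+ 2.
Proof. exact: cnorm_star. Qed.

HB.instance Definition _ := isCStarAlgebra.Build R subalg_type
  mA mDl mDr mZl mZr sK sD sZ sM nM nS.

Definition subalg_alg : cstarAlgType R := subalg_type.

End ClosedSubalgebra.

(** Only the embedding and its range matter later; the subtype stays hidden behind them. *)
Lemma closed_subalg_type (R : realType) (L : cstarAlgType R) (M : set L) :
  star_subalg M -> nclosed M ->
  exists (D : cstarAlgType R) (i : D -> L), [/\ star_hom i, injective i &
    forall x, M x <-> exists y, i y = x].
Proof.
move=> hM cM; exists (subalg_alg hM cM), (fun y : subalg_type hM cM => val y); split.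
- by split.
- exact: val_inj.
move=> x; split=> [Mx|[y <-]]; last by apply/(subalg_predP hM cM); apply: valP.
by have Px : subalg_pred hM cM x := introT (asboolP _) Mx; exists (Sub x Px : subalg_type hM cM).
Qed.

Lemma ncl_star_subalg (R : realType) (L : cstarAlgType R) (M : set L) :
  star_subalg M -> star_subalg (ncl M).
Proof.
move=> hM.
have lM : linear_set M by case: hM.
have [h0 h] := ncl_linear lM; split => //.
(* Products of limits in two stages, first with the left factor in [M]. *)
- have h1 a b : M a -> ncl M b -> ncl M (a ** b).
    move=> Ma; have := @nclosed_mull _ _ _ a (@ncl_ncl _ _ M); move=> cl Mb; apply: cl.
    by move=> e /Mb [c Mc hc]; exists c => //; apply: sub_ncl; apply: star_subalgM.
  move=> a b Ma Mb; apply: (@nclosed_mulr _ _ _ b (@ncl_ncl _ _ M)).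
  by move=> e /Ma [c Mc hc]; exists c => //; apply: h1.
- move=> a Ma; apply: (@nclosed_star _ _ _ (@ncl_ncl _ _ M)).
  by move=> e /Ma [c Mc hc]; exists c => //; apply: sub_ncl; apply: star_subalg_star.
Qed.

(** * The algebras as subalgebras of the core *)

Section Cores.
Context (R : realType) (k : option nat) (A : cstarAlgType R).
Context (X : product_system A k) (B : cstarAlgType R).
Context (psi : forall n : Nsum k, X n -> B).
Context (hpsi : is_representation psi) (hinj : rep_injective psi).
Context (hX : compactly_aligned X) (hCNP : CNP_covariant psi).
Implicit Types (p q r n m : Nsum k) (s : seq (Nsum k)).

(** Peeling off one K_p at a time matches [sum_set], the tail playing the ideal. *)
Fixpoint cpt_sum s : set B :=
  if s is p :: s' then sum_set (cpt_image psi p) (cpt_sum s') else [set 0]%classic.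

Lemma cpt_sum_linear s : linear_set (cpt_sum s).
Proof.
elim: s => [|p s IH] /=; first exact: linear_set0.
have [K0 Kl] := cpt_image_linear psi p; have [S0 Sl] := IH.
split; first by exists 0; rewrite ?subrr.
move=> c x y [a Ka hx] [b Kb hy]; exists (c *: a + b); first exact: Kl.
by rewrite opprD addrACA -scalerBr; apply: Sl.
Qed.

Lemma cpt_sum_mem s p b : p \in s -> cpt_image psi p b -> cpt_sum s b.
Proof.
elim: s => //= q s IH; rewrite inE => /orP[/eqP <- hb|ps hb].
  by exists b; rewrite ?subrr //; case: (cpt_sum_linear s).
by exists 0; [case: (cpt_image_linear psi q)|rewrite subr0; apply: IH].
Qed.

Lemma cpt_sum_min s (M : set B) : linear_set M ->
  (forall p b, p \in s -> cpt_image psi p b -> M b) -> forall b, cpt_sum s b -> M b.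
Proof.
move=> lM; elim: s => [|p s IH] hM b /=; first by move=> ->; case: lM.
move=> [a Ka hb]; rewrite -(subrK a b); apply: linear_setD => //.
  by apply: IH hb => q c qs; apply: hM; rewrite inE qs orbT.
by apply: hM Ka; rewrite inE eqxx.
Qed.

Lemma cpt_sumP s b : uniq s -> cpt_sum s b ->
  exists2 c : Nsum k -> B, (forall p, p \in s -> cpt_image psi p (c p)) &
    b = \sum_(p <- s) c p.
Proof.
elim: s b => [|p s IH] b /=; first by move=> _ ->; exists (fun=> 0) => //; rewrite big_nil.
move=> /andP[ps us] [a Ka /(IH _ us) [c hc hb]].
exists (fun q => if q == p then a else c q).
  by move=> q; rewrite inE; case: eqP => [->|_] //=; apply: hc.
rewrite big_cons eqxx -[LHS](subrKC a) hb; congr (_ + _).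
by rewrite !big_seq; apply: eq_bigr => q qs; case: eqP qs ps => // -> ->.
Qed.

Definition join_closed s : Prop :=
  forall p q, p \in s -> q \in s -> Njoin p q \in s.

(** The head [p] has least weight, so p v q differs from [p] for each later [q]. Hence K_p K_q lands
    in the tail, which K_p therefore multiplies into itself, and [nclosed_sum_set] applies. *)
Lemma cpt_sum_closed s : uniq s -> join_closed s ->
  sorted (fun p q => Nweight p <= Nweight q)%N s ->
  star_subalg (cpt_sum s) /\ nclosed (cpt_sum s).
Proof.
elim: s => [|p s IH] us js ss.
  split; last exact: nclosed0.
  by split => [c a b -> ->|//|a b -> _|a ->] /=; rewrite ?scaler0 ?addr0 ?cmul0l ?cstar0.
have tw : transitive (fun p q => Nweight p <= Nweight q)%N.
  by move=> x y z; apply: leq_trans.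
have /andP[ps us'] := us.
have hp q : q \in s -> Njoin p q != p.
  move=> qs; apply/eqP => h.
  have qp : Nle q p by rewrite -h; apply: Nle_joinr.
  have /allP /(_ q qs) /= hw := order_path_min tw ss.
  by move: ps; rewrite -(Nle_weight_eq qp hw) qs.
have js' : join_closed s.
  move=> q q' qs qs'; have := js q q'; rewrite !inE qs qs' !orbT => /(_ isT isT).
  case/orP => [/eqP h|//]; have qp : Nle q p by rewrite -h; apply: Nle_joinl.
  have /allP /(_ q qs) /= hw := order_path_min tw ss.
  by move: ps; rewrite -(Nle_weight_eq qp hw) qs.
have [hS cS] := IH us' js' (path_sorted ss).
have hid a x : cpt_image psi p a -> cpt_sum s x -> cpt_sum s (a ** x).
  move=> Ka; apply: (cpt_sum_min (M := [set x | cpt_sum s (a ** x)]%classic)).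
    by apply: linear_mull; apply: cpt_sum_linear.
  move=> q b qs Kb /=; apply: (@cpt_sum_mem s (Njoin p q)).
    have := js p q; rewrite !inE eqxx qs orbT => /(_ isT isT).
    by rewrite (negbTE (hp q qs)).
  exact: (cpt_image_join hpsi hinj hX hCNP.1).
have hK := cpt_image_subalg hpsi hinj p; have cK := @cpt_image_closed _ _ _ _ _ psi p.
split; first exact: sum_set_subalg.
exact: nclosed_sum_set.
Qed.

Definition lower_seq n : seq (Nsum k) :=
  sort (fun p q => Nweight p <= Nweight q)%N (fset_set [set p | Nle p n]%classic).

Lemma mem_lower_seq n p : (p \in lower_seq n) = `[< Nle p n >].
Proof.
rewrite mem_sort in_fset_set; last exact: Nle_finite.
by apply/idP/asboolP => [/set_mem|] // h; apply/mem_set.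
Qed.

Lemma lower_seq_uniq n : uniq (lower_seq n).
Proof. by rewrite sort_uniq fset_uniq. Qed.

Lemma sum_lower (V : zmodType) n (F : Nsum k -> V) :
  \sum_(p \in [set p | Nle p n]%classic) F p = \sum_(p <- lower_seq n) F p.
Proof.
rewrite fsbig_finite; last exact: Nle_finite.
by apply: perm_big; rewrite perm_sym perm_sort.
Qed.

Definition core_part n : set B := cpt_sum (lower_seq n).

Lemma core_part_closed n : star_subalg (core_part n) /\ nclosed (core_part n).
Proof.
apply: cpt_sum_closed; first exact: lower_seq_uniq.
  move=> p q; rewrite !mem_lower_seq => /asboolP hp /asboolP hq.
  by apply/asboolP; apply: Njoin_lub.
by apply: sort_sorted => p q; apply: leq_total.
Qed.

Lemma core_part_min n (M : set B) : linear_set M ->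
  (forall p b, Nle p n -> cpt_image psi p b -> M b) -> forall b, core_part n b -> M b.
Proof.
move=> lM hM; apply: cpt_sum_min => // p b.
by rewrite mem_lower_seq => /asboolP; apply: hM.
Qed.

Lemma core_part_le n m b : Nle n m -> core_part n b -> core_part m b.
Proof.
move=> nm; apply: core_part_min; first exact: cpt_sum_linear.
move=> p c pn; apply: cpt_sum_mem; rewrite mem_lower_seq; apply/asboolP.
exact: Nle_trans pn nm.
Qed.

Lemma core_partP n b : core_part n b ->
  exists2 S : forall p, X p -> X p, compact_upto n S &
    b = \sum_(p <- lower_seq n) psiK psi (S p).
Proof.
move=> /(cpt_sumP (lower_seq_uniq n)) [c hc ->].
exists (fun p => mul_op psi (c p)).
  move=> p pn; apply: mul_op_compact => //; apply: hc.
  by rewrite mem_lower_seq; apply/asboolP.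
by rewrite !big_seq; apply: eq_bigr => p hp; rewrite psiK_mul_op //; apply: hc.
Qed.

Lemma core_part_sum n (S : forall p, X p -> X p) : compact_upto n S ->
  core_part n (\sum_(p <- lower_seq n) psiK psi (S p)).
Proof.
move=> hS; apply: linear_set_sum; first exact: cpt_sum_linear.
move=> p hp; apply: cpt_sum_mem (hp) _; apply: psiK_cpt => //; apply: hS.
by move: hp; rewrite mem_lower_seq => /asboolP.
Qed.

(** The element of C~_n attached to [b], extended by 0 in the same way as [tilde_elt], so that the
    two can be equal as functions. *)
Definition mul_family n (b : B) : opfamily X := fun q r =>
  if `[< Nle n q /\ Nle r q >]
  then (patch (fun=> 0) (@XI _ _ _ X q r) (mul_op psi b : X r -> X r)) else 0.

(** A summand from K_p preserves the fibre if p <= r and kills [psi z] by [XI_vanish] otherwise. *)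
Lemma core_part_fibre n q r b (z : X r) : Nle n q -> Nle r q -> XI q z ->
  core_part n b -> in_fibre psi r (b ** psi z).
Proof.
move=> nq rq hz; apply: (core_part_min (M := [set b | in_fibre psi r (b ** psi z)]%classic)).
  by apply: linear_mulr; apply: in_fibre_linear.
move=> p c pn hc /=; have [pr|pr] := pselect (Nle p r).
  exact: cpt_image_fibre.
rewrite (XI_vanish hpsi hinj hX hCNP.1 hc hz) //; last exact: Nle_trans pn nq.
by case: (in_fibre_linear hpsi r).
Qed.

Lemma mul_familyE n q r b (z : X r) : core_part n b -> Nle n q -> Nle r q -> XI q z ->
  psi (mul_family n b q z) = b ** psi z.
Proof.
move=> hb nq rq hz; rewrite /mul_family asboolT // patchT ?mem_set // mul_opE //.
exact: core_part_fibre hb.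
Qed.

Lemma mul_family0 n q r b (z : X r) : ~ (Nle n q /\ Nle r q /\ XI q z) ->
  mul_family n b q z = 0.
Proof.
rewrite /mul_family; case: asboolP => // -[nq rq] h.
by rewrite patchC // in_setC; apply/negP => /set_mem hz; apply: h.
Qed.

Lemma mul_family_eq n b (x : opfamily X) : core_part n b ->
  (forall q r (z : X r), ~ (Nle n q /\ Nle r q /\ XI q z) -> x q r z = 0) ->
  (forall q r (z : X r), Nle n q -> Nle r q -> XI q z -> psi (x q r z) = b ** psi z) ->
  x = mul_family n b.
Proof.
move=> hb h0 h; apply: functional_extensionality_dep => q.
apply: functional_extensionality_dep => r; apply/funext => z.
have [[nq [rq hz]]|hn] := pselect (Nle n q /\ Nle r q /\ XI q z).
  by apply: (rep_inj hpsi hinj); rewrite mul_familyE // h.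
by rewrite mul_family0 // h0.
Qed.

(** The component at [r] only involves the S_p with p <= r; by [XI_vanish] the others may be added,
    since they contribute 0. So all components come from one element of [B]. *)
Lemma tilde_elt_mul_family n (S : forall p, X p -> X p) : compact_upto n S ->
  tilde_elt n S = mul_family n (\sum_(p <- lower_seq n) psiK psi (S p)).
Proof.
move=> hS; apply: mul_family_eq; first exact: core_part_sum.
  move=> q r z hn; rewrite /tilde_elt; case: asboolP => // nq.
  rewrite sum_lower fct_sumE big1 // => p _.
  rewrite /iota_tilde; case: asboolP => // -[_ rq].
  by rewrite patchC // in_setC; apply/negP => /set_mem hz; apply: hn.
move=> q r z nq rq hz; rewrite /tilde_elt asboolT // sum_lower fct_sumE.
rewrite (big_morph (@psi r) (@repD _ _ _ _ _ _ hpsi r) (rep0 hpsi r)) cmul_suml.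
rewrite !big_seq; apply: eq_bigr => p; rewrite mem_lower_seq => /asboolP pn.
rewrite /iota_tilde; case: asboolP => [[pr _]|hn].
  by rewrite patchT ?mem_set // (iota_opE hpsi hinj pr (hS p pn)).
rewrite rep0 // (XI_vanish hpsi hinj hX hCNP.1 (psiK_cpt hpsi hinj (hS p pn)) hz) //.
  exact: Nle_trans pn nq.
by move=> pr; apply: hn.
Qed.

Lemma mul_family_core n (S : forall p, X p -> X p) : compact_upto n S ->
  Ctilde n (mul_family n (\sum_(p <- lower_seq n) psiK psi (S p))).
Proof. by move=> hS; exists S => //; rewrite tilde_elt_mul_family. Qed.

Lemma mul_family_Ctilde n b : core_part n b -> Ctilde n (mul_family n b).
Proof. by move=> /core_partP [S hS ->]; apply: mul_family_core. Qed.

Lemma Ctilde_mul_family n x : Ctilde n x -> exists2 b, core_part n b & x = mul_family n b.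
Proof.
move=> [S hS ->]; exists (\sum_(p <- lower_seq n) psiK psi (S p)).
  exact: core_part_sum.
exact: tilde_elt_mul_family.
Qed.

Lemma mul_family_lin n (c : R[i]) b b' : core_part n b -> core_part n b' ->
  opfamily_lin c (mul_family n b) (mul_family n b') = mul_family n (c *: b + b').
Proof.
move=> hb hb'; apply: mul_family_eq.
- by case: (cpt_sum_linear (lower_seq n)) => _; apply.
- by move=> q r z hn; rewrite /opfamily_lin /= !fctE !mul_family0 // scaler0 addr0.
- move=> q r z nq rq hz; rewrite /opfamily_lin !fctE (repP hpsi) !mul_familyE //.
  by rewrite cmulDl cmulZl.
Qed.

Lemma XI_mul_family n q r b (z : X r) : core_part n b -> Nle n q -> Nle r q ->
  XI q z -> XI q (mul_family n b q z).
Proof.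
move=> hb nq rq hz; have hf := core_part_fibre nq rq hz hb.
suff -> : mul_family n b q z = mul_op psi b z by apply: (XI_ideal hpsi hinj hf hz).
by rewrite /mul_family asboolT // patchT ?mem_set.
Qed.

Lemma mul_family_mul n b b' : core_part n b -> core_part n b' ->
  opfamily_mul (mul_family n b) (mul_family n b') = mul_family n (b ** b').
Proof.
move=> hb hb'; apply: mul_family_eq.
- by case: (core_part_closed n) => h _; apply: star_subalgM.
(* Off the domain the inner family returns 0, and the outer one has to send 0 to 0. *)
- move=> q r z hn; rewrite /opfamily_mul /= (@mul_family0 n q r b' z) //.
  have [[nq rq]|hn'] := pselect (Nle n q /\ Nle r q).
    apply: (rep_inj hpsi hinj); rewrite mul_familyE //.
      by rewrite rep0 // cmul0r.
    by apply/(XIP hpsi hinj) => m y _ _; rewrite rep0 // cmul0l.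
  by rewrite mul_family0 // => -[h1 [h2 _]]; apply: hn'.
- move=> q r z nq rq hz; rewrite /opfamily_mul /= mul_familyE //.
    by rewrite mul_familyE // cmulA.
  exact: XI_mul_family.
Qed.

Lemma mul_family_adjoint n b : core_part n b ->
  opfamily_adjoint (mul_family n b) (mul_family n (cstar b)).
Proof.
move=> hb q r rq u v hu hv.
have hb' : core_part n (cstar b).
  by case: (core_part_closed n) => h _; apply: star_subalg_star.
apply: (rep_unit_inj hinj); rewrite -!(rep_inner hpsi).
have [nq|hn] := pselect (Nle n q).
  by rewrite !mul_familyE // cstarM cmulA.
rewrite !mul_family0; try by move=> [].
by rewrite !rep0 // cstar0 cmul0l cmul0r.
Qed.

(** Cocones express the involution through [opfamily_adjoint], which therefore has to determine the
    adjoint. The difference [w] of two candidates stays in X_r I_(q-r), so it can be tested against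
    itself. *)
Lemma mul_family_adjoint_uniq n b b' : core_part n b -> core_part n b' ->
  opfamily_adjoint (mul_family n b) (mul_family n b') ->
  mul_family n b' = mul_family n (cstar b).
Proof.
move=> hb hb' hadj.
have hbs : core_part n (cstar b).
  by case: (core_part_closed n) => h _; apply: star_subalg_star.
apply: mul_family_eq => // q r z; first exact: mul_family0.
move=> nq rq hz.
pose w := mul_family n b' q z - mul_family n (cstar b) q z.
have hw : XI q w.
  apply/(XIP hpsi hinj) => m y m0 hm; rewrite (repB hpsi) !mul_familyE //.
  have /(XIP hpsi hinj) h := hz.
  by rewrite cmulBl -!cmulA h // !cmul0r subrr.
rewrite -(mul_familyE hbs nq rq hz); apply/eqP; rewrite -subr_eq0 -(repB hpsi).
have hw2 : psi w = psi (mul_family n b' q z) - psi (mul_family n (cstar b) q z).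
  exact: repB.
apply/eqP/sstar_eq0; rewrite -/w {2}hw2 cmulBr !(rep_inner hpsi).
rewrite -(hadj q r rq w z hw hz) -(mul_family_adjoint hb rq hw hz).
by rewrite subrr.
Qed.

(** CNP-covariance enters here: this is the well-definedness of kappa~_n. Its injectivity is
    immediate, as [b] determines the family. *)
Lemma mul_family_inj n b b' : core_part n b -> core_part n b' ->
  mul_family n b = mul_family n b' -> b = b'.
Proof.
move=> hb hb' hbb.
have hd : core_part n (b - b').
  by case: (core_part_closed n) => h _; apply: star_subalgB.
have [S hS hdS] := core_partP hd.
apply/eqP; rewrite -subr_eq0 hdS; apply/eqP.
have h0 : forall q r (z : X r), tilde_elt n S q z = 0.
  move=> q r z; rewrite tilde_elt_mul_family // -hdS.
  have [[nq [rq hz]]|hn] := pselect (Nle n q /\ Nle r q /\ XI q z); last first.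
    exact: mul_family0.
  apply: (rep_inj hpsi hinj); rewrite mul_familyE // cmulBl.
  by rewrite -!(mul_familyE _ nq rq hz) // hbb subrr rep0.
have := hCNP.2 (fset_set [set p | Nle p n]%classic) S.
rewrite -fsbig_finite ?sum_lower; last exact: Nle_finite.
apply.
  by move=> p; rewrite in_fset_set ?inE; [move=> h; apply: hS|exact: Nle_finite].
(* The components are known to vanish from [n] on, so the bound is taken above [n] as well. *)
move=> n0; exists (Njoin n0 n); first exact: Nle_joinl.
move=> q hq r; apply/funext => z.
have nq : Nle n q := Nle_trans (Nle_joinr n0 n) hq.
have := h0 q r z; rewrite /tilde_elt asboolT // fsbig_finite //; exact: Nle_finite.
Qed.

Lemma jtilde_mul_family n m b : Nle n m -> core_part n b ->
  jtilde m (mul_family n b) = mul_family m b.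
Proof.
move=> nm hb; apply: mul_family_eq; first exact: core_part_le hb.
  move=> q r z hn; rewrite /jtilde; case: asboolP => // mq.
  by apply: mul_family0 => -[_ h]; apply: hn.
move=> q r z mq rq hz; rewrite /jtilde asboolT // mul_familyE //.
exact: Nle_trans mq.
Qed.

(** The map kappa~_n as the inverse of [mul_family n], with default 0 outside C~_n. *)
Definition kappa n (x : opfamily X) : B :=
  xget 0 [set b | core_part n b /\ x = mul_family n b]%classic.

Lemma kappa_mul_family n b : core_part n b -> kappa n (mul_family n b) = b.
Proof.
move=> hb; apply: xget_unique => // b' [hb' /esym h].
exact: mul_family_inj h.
Qed.

Lemma kappa_cocone : is_cocone kappa.
Proof.
split.
  move=> n x y /Ctilde_mul_family [b hb ->] /Ctilde_mul_family [b' hb' ->].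
  have [hc _] := core_part_closed n.
  split.
  - move=> c; rewrite mul_family_lin // !kappa_mul_family //.
    exact: star_subalg_lin.
  - by rewrite mul_family_mul // !kappa_mul_family //; apply: star_subalgM.
  - move=> /(mul_family_adjoint_uniq hb hb') ->; rewrite !kappa_mul_family //.
    exact: star_subalg_star.
move=> n m nm x /Ctilde_mul_family [b hb ->].
rewrite jtilde_mul_family // !kappa_mul_family //; exact: core_part_le hb.
Qed.

End Cores.

(** * The inductive limit *)

Section Limit.
Context (R : realType) (k : option nat) (A : cstarAlgType R).
Context (X : product_system A k) (B : cstarAlgType R).
Context (psi : forall n : Nsum k, X n -> B).
Context (hpsi : is_representation psi) (hinj : rep_injective psi).
Context (hX : compactly_aligned X) (hCNP : CNP_covariant psi).
Context (L : cstarAlgType R) (lam : Nsum k -> opfamily X -> L).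
Context (hL : is_inductive_limit lam).
Implicit Types (n m : Nsum k).

(** The inverse of kappa~_n followed by [f n], a map on the subset B_n of [B]. *)
Definition core_lift (D : cstarAlgType R) (f : Nsum k -> opfamily X -> D) n (b : B) : D :=
  f n (mul_family psi n b).

Lemma core_lift_star_hom (D : cstarAlgType R) (f : Nsum k -> opfamily X -> D) n :
  is_cocone f -> star_hom_on (core_part psi n) (core_lift f n).
Proof.
move=> [hf _].
have hC b : core_part psi n b -> Ctilde n (mul_family psi n b).
  exact: mul_family_Ctilde.
split.
- move=> c a b ha hb; have [h _ _] := hf n _ _ (hC _ ha) (hC _ hb).
  by rewrite /core_lift -h (mul_family_lin hpsi hinj hX hCNP).
- move=> a b ha hb; have [_ h _] := hf n _ _ (hC _ ha) (hC _ hb).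
  by rewrite /core_lift -h (mul_family_mul hpsi hinj hX hCNP).
- move=> a ha; have ha' : core_part psi n (cstar a).
    have [h _] := core_part_closed hpsi hinj hX hCNP n.
    exact: star_subalg_star.
  have [_ _ h] := hf n _ _ (hC _ ha) (hC _ ha').
  by rewrite /core_lift -h //; apply: mul_family_adjoint.
Qed.

Lemma core_lift_le (D : cstarAlgType R) (f : Nsum k -> opfamily X -> D) n m b :
  is_cocone f -> Nle n m -> core_part psi n b -> core_lift f m b = core_lift f n b.
Proof.
move=> [_ hf] nm hb; rewrite /core_lift -(hf n m nm); last exact: mul_family_Ctilde.
by rewrite (jtilde_mul_family hpsi hinj hX hCNP).
Qed.

Let lam_image : set L := [set y | exists n b, core_part psi n b /\ y = core_lift lam n b]%classic.

Let lam_image_subalg : star_subalg lam_image.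
Proof.
have hlam : is_cocone lam := hL.1.
have hS n := (core_part_closed hpsi hinj hX hCNP n).1.
have hh n := core_lift_star_hom n hlam.
have common y y' : lam_image y -> lam_image y' -> exists n b b',
    [/\ core_part psi n b, core_part psi n b', y = core_lift lam n b & y' = core_lift lam n b'].
  move=> [n [b [hb ->]]] [n' [b' [hb' ->]]]; exists (Njoin n n'), b, b'.
  have h1 := Nle_joinl n n'; have h2 := Nle_joinr n n'.
  split; [exact: core_part_le h1 hb|exact: core_part_le h2 hb'| |].
    by rewrite (core_lift_le hlam h1).
  by rewrite (core_lift_le hlam h2).
split.
- move=> c y y' hy hy'; have [n [b [b' [hb hb' -> ->]]]] := common _ _ hy hy'.
  exists n, (c *: b + b'); split; first exact: star_subalg_lin.
  by rewrite (star_hom_on_lin (hh n)).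
- exists Nzero, 0; split; first exact: star_subalg0.
  by rewrite (star_hom_on0 (hS _) (hh _)).
- move=> y y' hy hy'; have [n [b [b' [hb hb' -> ->]]]] := common _ _ hy hy'.
  exists n, (b ** b'); split; first exact: star_subalgM.
  by rewrite (star_hom_onM (hh n)).
- move=> _ [n [b [hb ->]]]; exists n, (cstar b); split; first exact: star_subalg_star.
  by rewrite (star_hom_on_star (hh n)).
Qed.

(* The closure of the image is itself a C*-algebra receiving the cocone, so the identity of
   [L] factors through it. *)
Lemma inductive_limit_dense y : ncl lam_image y.
Proof.
have hlam : is_cocone lam := hL.1.
have [D [i [hi iinj hM]]] := closed_subalg_type (ncl_star_subalg lam_image_subalg) (@ncl_ncl _ _ _).
(* The corestriction of [lam n]; the default 0 occurs only outside C~_n. *)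
pose lam' n x : D := xget 0 [set d | i d = lam n x]%classic.
have hlam' n x : Ctilde n x -> i (lam' n x) = lam n x.
  move=> hx; have [b hb ->] := Ctilde_mul_family hpsi hinj hX hCNP hx.
  have /hM [d hd] : ncl lam_image (lam n (mul_family psi n b)).
    by apply: sub_ncl; exists n, b.
  by apply: (@xgetPex _ 0 [set d | i d = _]%classic); exists d.
have [ilin imul istar] := hi.
have cl n (x y' : opfamily X) : Ctilde n x -> Ctilde n y' ->
    (forall c : R[i], Ctilde n (opfamily_lin c x y')) /\
    Ctilde n (opfamily_mul x y').
  move=> hx hy; have [b hb ->] := Ctilde_mul_family hpsi hinj hX hCNP hx.
  have [b' hb' ->] := Ctilde_mul_family hpsi hinj hX hCNP hy.
  have hS := (core_part_closed hpsi hinj hX hCNP n).1.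
  split=> [c|].
    rewrite (mul_family_lin hpsi hinj hX hCNP) //.
    by apply: mul_family_Ctilde => //; apply: star_subalg_lin.
  rewrite (mul_family_mul hpsi hinj hX hCNP) //.
  by apply: mul_family_Ctilde => //; apply: star_subalgM.
have hc' : is_cocone lam'.
  split.
    move=> n x y' hx hy; have [h1 h2 h3] := hlam.1 n x y' hx hy.
    have [cl1 cl2] := cl n x y' hx hy.
    split=> [c||hadj]; apply: iinj; rewrite ?ilin ?imul ?istar !hlam' //.
    exact: h3.
  move=> n m nm x hx; apply: iinj; rewrite !hlam' //; first exact: hlam.2.
  have [b hb ->] := Ctilde_mul_family hpsi hinj hX hCNP hx.
  rewrite (jtilde_mul_family hpsi hinj hX hCNP) //.
  by apply: mul_family_Ctilde => //; apply: core_part_le hb.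
have [g [[[glin gmul gstar] hg] _]] := hL.2 D lam' hc'.
have [h [_ huniq]] := hL.2 L lam hlam.
have h1 : h = i \o g.
  apply: huniq; split; last by move=> n x hx /=; rewrite hg // hlam'.
  by split=> *; rewrite /= ?glin ?gmul ?gstar ?ilin ?imul ?istar.
have h2 : h = id by apply: huniq; split; [split|].
by apply/hM; exists (g y); have := congr1 (@^~ y) h1; rewrite h2.
Qed.

Lemma core_part_rep_core n b : core_part psi n b -> rep_core psi b.
Proof.
rewrite /rep_core -nclE; apply: core_part_min.
  exact/ncl_linear/linear_span_linear.
move=> p c _; apply: ncl_span_min.
- exact/ncl_linear/linear_span_linear.
- exact: ncl_ncl.
- by move=> _ [x [y ->]]; apply: sub_ncl; apply: linear_span_sub; exists p, x, y.
Qed.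

Lemma limit_kappa_isometric : exists kap : L -> B,
  unique (is_limit_kappa psi lam) kap /\ forall y, `|kap y| = `|y|.
Proof.
have hlam : is_cocone lam := hL.1.
have hkc := kappa_cocone hpsi hinj hX hCNP.
have [g [[hg hgk] guniq]] := hL.2 B (kappa psi) hkc.
have [glin gmul gstar] := hg.
have gT : star_hom_on [set: L]%classic g by split.
have gcore n b : core_part psi n b -> g (core_lift lam n b) = b.
  move=> hb; rewrite /core_lift hgk; last exact: mul_family_Ctilde.
  exact: kappa_mul_family.
have gle y : nm (g y) <= nm y := star_hom_contr (star_subalgT L) gT (@nclosedT _ L) I.
(* The homomorphism from the closed B_n is contractive; together with [gcore] and [gle] this makes
   [g] isometric on the image of C~_n. *)
have giso n b : core_part psi n b -> nm (core_lift lam n b) <= nm b.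
  move=> hb; have [h1 h2] := core_part_closed hpsi hinj hX hCNP n.
  exact: (star_hom_contr h1 (core_lift_star_hom n hlam) h2 hb).
have gB x y : g (x - y) = g x - g y by apply: (star_hom_onB (star_subalgT L) gT).
exists g; split; last first.
  move=> y; rewrite !nmE; congr (_%:C)%C; apply/eqP; rewrite eq_le gle /=.
  apply/ler_addgt0Pr => e e0.
  have e2 : 0 < e / 2 by rewrite divr_gt0.
  (* Density carries the isometry over to [y]: passing from [y] to the approximant and from [b] back
     to [g y] costs e / 2 each. *)
  have [_ [n [b [hb ->]]] hd] := @inductive_limit_dense y _ e2.
  have h1 := nmBr y (core_lift lam n b); have h2 := giso _ _ hb.
  have h3 := nmBr b (g y); have h4 := gle (core_lift lam n b - y).
  rewrite gB gcore // (nmBC (core_lift lam n b)) in h4.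
  lra.
split.
  split => //.
    move=> y; rewrite /rep_core -nclE; apply: ncl_ncl => e e0.
    have [_ [n [b [hb ->]]] hd] := @inductive_limit_dense y e e0.
    exists b; first by have := core_part_rep_core hb; rewrite /rep_core -nclE.
    by rewrite -(gcore _ _ hb) -gB; apply: (le_trans (gle _)).
  move=> n S hS /=; rewrite (tilde_elt_mul_family hpsi hinj hX hCNP hS) // hgk;
    last exact: mul_family_core.
  by rewrite kappa_mul_family ?sum_lower //; apply: core_part_sum.
move=> g' [hg' _ hk']; apply: guniq; split => // n x [S hS ->].
rewrite [LHS]hk' // (tilde_elt_mul_family hpsi hinj hX hCNP hS) // kappa_mul_family ?sum_lower //.
exact: core_part_sum.
Qed.

End Limit.

Theorem theorem4p10 (R : realType) (k : option nat) (hk : rank_ge1 k)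
    (A : cstarAlgType R) (X : product_system A k) (hX : compactly_aligned X)
    (B : cstarAlgType R) (psi : forall n : Nsum k, X n -> B)
    (hpsi : is_representation psi) (hinj : rep_injective psi)
    (hCNP : CNP_covariant psi)
    (L : cstarAlgType R) (lam : Nsum k -> opfamily X -> L)
    (hL : is_inductive_limit lam) :
  exists kap : L -> B,
    unique (is_limit_kappa psi lam) kap /\ forall x : L, `|kap x| = `|x|.
Proof. exact: (limit_kappa_isometric hpsi hinj hX hCNP hL). Qed.
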